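(* Let $\alpha$ be a complex number with $\mathrm{Re}\,\alpha>-1/2$, let $E_{11},E_{12},E_{21},E_{22}$ be fixed complex scalars, and for $n\ge2$ let $E_n$ be the $n\times n$ matrix with entries $E_{11},E_{12},E_{21},E_{22}$ in the positions $(1,1),(1,n),(n,1),(n,n)$, respectively, and zeros elsewhere. Then, as $n\to\infty$, $\det(T_n(\xi_\alpha\eta_\alpha)+E_n)/\det T_n(\xi_\alpha\eta_\alpha)$ equals $$\begin{vmatrix}1+E_{11}&E_{12}\\ E_{21}&1+E_{22}\end{vmatrix}+\frac{\alpha}{n}\left(E_{12}+E_{21}-\alpha(E_{11}+E_{22})-2\alpha\begin{vmatrix}E_{11}&E_{12}\\ E_{21}&E_{22}\end{vmatrix}\right)+O\left(\frac1{n^2}\right).$$ If in particular $$\begin{pmatrix}E_{11}&E_{12}\\ E_{21}&E_{22}\end{pmatrix}=\begin{pmatrix}0&1\\ 1&0\end{pmatrix},$$ then $$\frac{\det(T_n(\xi_\alpha\eta_\alpha)+E_n)}{\det T_n(\xi_\alpha\eta_\alpha)}=\frac{2\alpha(\alpha+1)}{n}+O\left(\frac1{n^2}\right).$$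
   Context: For $t$ on the unit circle $\mathbf{T}$ (with $t\neq1$), $\xi_\alpha(t)=(1-1/t)^\alpha=\sum_{k=0}^\infty(-1)^k\binom{\alpha}{k}t^{-k}$ and $\eta_\alpha(t)=(1-t)^\alpha=\sum_{k=0}^\infty(-1)^k\binom{\alpha}{k}t^{k}$, so that $\xi_\alpha(t)\eta_\alpha(t)=|1-t|^{2\alpha}$, which is in $L^1(\mathbf{T})$ for $\mathrm{Re}\,\alpha>-1/2$. For $a\in L^1(\mathbf{T})$ with Fourier coefficients $a_k=\frac1{2\pi}\int_{-\pi}^{\pi}a(e^{i\theta})e^{-ik\theta}\,d\theta$, $T_n(a)=(a_{j-k})_{j,k=1}^n$. It is known that $T_n(\xi_\alpha\eta_\alpha)$ is invertible for every $n\ge1$ when $\mathrm{Re}\,\alpha>-1/2$. Vertical bars around a square matrix denote its determinant. *)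

(* Defs.v *)
From HB Require Import structures.
From mathcomp Require Import all_boot all_order all_algebra.
From mathcomp Require Import all_classical all_reals all_analysis.
From mathcomp Require Import complex.
Set Implicit Arguments.
Unset Strict Implicit.
Unset Printing Implicit Defensive.
Import Order.TTheory GRing.Theory Num.Theory.
Import numFieldNormedType.Exports.
Local Open Scope classical_set_scope.
Local Open Scope ring_scope.
Local Open Scope complex_scope.

Definition expi (R : realType) (x : R) : R[i] := cos x +i* sin x.

Definition Cexp (R : realType) (z : R[i]) : R[i] :=
  (expR (complex.Re z))%:C * expi (complex.Im z).

(* Principal argument, with values in ]-pi, pi] for z != 0. *)
Definition Carg (R : realType) (z : R[i]) : R :=
  let x := acos (complex.Re z / complex.Re `|z|) in
  if 0 <= complex.Im z then x else - x.

Definition Clog (R : realType) (z : R[i]) : R[i] :=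
  ln (complex.Re `|z|) +i* Carg z.

(* Principal branch of the power. The value at z = 0 is irrelevant below: it
   only affects the symbols at the single point t = 1 of the circle. *)
Definition Cpow (R : realType) (z a : R[i]) : R[i] := Cexp (a * Clog z).

Definition symb_xi (R : realType) (a t : R[i]) : R[i] := Cpow (1 - t^-1) a.

Definition symb_eta (R : realType) (a t : R[i]) : R[i] := Cpow (1 - t) a.

(* Lebesgue integral of a complex-valued function, taken componentwise. *)
Definition Cintegral (R : realType) (D : set R) (f : R -> R[i]) : R[i] :=
  (\int[lebesgue_measure]_(x in D) complex.Re (f x)) +i*
  (\int[lebesgue_measure]_(x in D) complex.Im (f x)).

(* A symbol is a function on the unit circle, represented by a function on
   R[i] of which only the values at the points expi x are used. *)
Definition fourier_coef (R : realType) (a : R[i] -> R[i]) (k : int) : R[i] :=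
  ((2 * pi)^-1)%:C *
  Cintegral `[- pi, pi] (fun x => a (expi x) * expi (- (k%:~R * x))).

Definition toeplitz (R : realType) (a : R[i] -> R[i]) (n : nat) : 'M[R[i]]_n :=
  \matrix_(j < n, k < n) fourier_coef a (j%:Z - k%:Z).

Definition mx2 (T : Type) (a b c d : T) : 'M[T]_2 :=
  \matrix_(i < 2, j < 2)
    if i == 0%N :> nat then (if j == 0%N :> nat then a else b)
    else (if j == 0%N :> nat then c else d).

(* Meaningful for n >= 2, when the four corners are distinct positions. *)
Definition corner_mx (R : nzRingType) (a b c d : R) (n : nat) : 'M[R]_n :=
  \matrix_(i < n, j < n)
    if (i == 0%N :> nat) && (j == 0%N :> nat) then a
    else if (i == 0%N :> nat) && (j == n.-1 :> nat) then b
    else if (i == n.-1 :> nat) && (j == 0%N :> nat) then c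
    else if (i == n.-1 :> nat) && (j == n.-1 :> nat) then d
    else 0.

(* Main.v *)
Require Import Defs.
From HB Require Import structures.
From mathcomp Require Import all_boot all_order all_algebra.
From mathcomp Require Import all_classical all_reals all_analysis.
From mathcomp Require Import complex.
From mathcomp Require Import measurable_realfun.
From mathcomp Require Import ring lra zify.
Import Order.TTheory GRing.Theory Num.Theory.
Import numFieldNormedType.Exports.
Local Open Scope classical_set_scope.
Local Open Scope ring_scope.
Local Open Scope complex_scope.
Set Implicit Arguments.
Unset Strict Implicit.
Unset Printing Implicit Defensive.
Import Normc.

(* Up to a constant, the Fourier coefficients a_k of w^alpha, where
   w = |1 - t|^2, are determined by the two-term recurrence
   (k + 1 + alpha) a_{k+1} = (k - alpha) a_k, which is obtained by integrating
   the derivative of w^alpha (1 - t) t^{-k-1} over the circle.  For the n x n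
   Toeplitz matrix T and K = diag(0, ..., n-1), the recurrence says that T K
   and T differ by a first-order difference operator.  If v is a kernel vector
   of T and n is minimal, then T K v is constant; by induction all polynomial
   vectors are in the image of T, so T is invertible.  If u = T^{-1} e_1, then
   T (K + alpha) u is constant, hence (K + alpha) u is palindromic, which gives
   the ratio of the corner entries p_n and q_n of T^{-1}, and with the Levinson
   recursion p_{n+1} / p_n = (n + alpha)^2 / (n (n + 2 alpha)).

   It remains to show p_n -> 1.  The mean of w^{alpha + m}, divided by that of
   (4^alpha) w^m, tends to 1 because w^m concentrates at t = -1; by the
   recurrence in alpha of these means, this quotient times p_m is a product of
   the factors 1 + 2 alpha / j over m < j <= 2m divided by 4^alpha, which tends
   to 1 as well. *)


(** * Toeplitz matrices with a two-term coefficient recurrence *)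

Section ToeplitzRecurrence.
Variables (F : numFieldType) (al : F) (a : int -> F).
Hypothesis a_rec : forall k : int,
  (k%:~R + 1 + al) * a (k + 1) = (k%:~R - al) * a k.
Definition toep n : 'M[F]_n := \matrix_(i, j) a (i%:Z - j%:Z).

(** The row index [j] ranges over all integers, so that the recurrence of [a] applies without range
    conditions. *)
Definition conv n (y : 'cV[F]_n) (j : int) : F := \sum_(k < n) a (j - k%:Z) * y k 0.

Definition kmul n (y : 'cV[F]_n) : 'cV[F]_n := \col_(k < n) (k%:R * y k 0).

Lemma toep_conv n (y : 'cV_n) i : (toep n *m y) i 0 = conv y i%:Z.
Proof. by rewrite mxE; apply: eq_bigr => k _; rewrite mxE. Qed.

Lemma conv_lin n (x y : 'cV_n) p q j :
  conv (p *: x + q *: y) j = p * conv x j + q * conv y j.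
Proof.
rewrite /conv !mulr_sumr -big_split; apply: eq_bigr => k _.
by rewrite !mxE /=; ring.
Qed.

Lemma convZ n (x : 'cV_n) p j : conv (p *: x) j = p * conv x j.
Proof. by rewrite -[p *: x]addr0 -(scale0r x) conv_lin mul0r addr0. Qed.

(* The two-term recurrence of the coefficients lets the Toeplitz operator pass
   through multiplication by the index, at the cost of a difference operator. *)
Lemma conv_kmul n (y : 'cV_n) (j : int) :
  conv (kmul y) (j + 1) - conv (kmul y) j =
  (j%:~R + 1 + al) * conv y (j + 1) - (j%:~R - al) * conv y j.
Proof.
rewrite /conv !mulr_sumr -!sumrB; apply: eq_bigr => k _; rewrite !mxE.
have := a_rec (j - k%:Z).
have -> : j - k%:Z + 1 = j + 1 - k%:Z by lia.
rewrite rmorphB /= -pmulrn => e.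
apply/eqP; rewrite -subr_eq0; apply/eqP.
have -> : forall x : F, a (j + 1 - k%:Z) * (k%:R * x) - a (j - k%:Z) * (k%:R * x) -
  ((j%:~R + 1 + al) * (a (j + 1 - k%:Z) * x) -
   (j%:~R - al) * (a (j - k%:Z) * x)) =
  - ((j%:~R - k%:R + 1 + al) * a (j + 1 - k%:Z)
     - (j%:~R - k%:R - al) * a (j - k%:Z)) * x by move=> x; ring.
  by rewrite e subrr oppr0 mul0r.
Qed.

Lemma conv_kmulS n (y : 'cV_n) (j : nat) :
  conv (kmul y) j.+1 - conv (kmul y) j =
  (j%:R + 1 + al) * conv y j.+1 - (j%:R - al) * conv y j.
Proof.
by have := conv_kmul y j; rewrite -pmulrn (_ : j%:Z + 1 = j.+1) //; lia.
Qed.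

Hypothesis al1 : forall n : nat, n.+1%:R + al != 0.

(** The recurrence at [n] and at [- (n + 1)] is the same relation for [a n] and [a (- n)]; [al1]
    allows division by [n + 1 + al]. *)
Lemma coef_sym k : a (- k) = a k.
Proof.
have symn (n : nat) : a (- n%:Z) = a n.
  elim: n => [|n IH]; first by rewrite oppr0.
  have := a_rec (- n.+1%:Z); have := a_rec n.
  have -> : - n.+1%:Z + 1 = - n%:Z by lia.
  have -> : n%:Z + 1 = n.+1 by lia.
  rewrite IH mulrNz -!pmulrn -[n.+1%:R]natr1 => e1 e2.
  apply: (mulfI (al1 n)); rewrite -[n.+1%:R]natr1.
  have -> : (n%:R + 1 + al) * a (- n.+1%:Z) =
    - ((- (n%:R + 1) - al) * a (- n.+1%:Z)) by ring.
  by rewrite -e2 e1; ring.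
by case: (intP k) => [|n|n]; rewrite ?opprK ?oppr0 ?symn.
Qed.

Lemma toep_sym n : (toep n)^T = toep n.
Proof.
by apply/matrixP => i j; rewrite !mxE -coef_sym opprB.
Qed.

Lemma diff_eq (f g : nat -> F) n :
  (forall j, (j < n)%N -> f j.+1 - f j = g j.+1 - g j) ->
  forall j, (j <= n)%N -> f j = f 0%N + g j - g 0%N.
Proof.
move=> fg; elim=> [|j IH] jn; first by ring.
have := fg j jn; rewrite (IH (ltnW jn)) => e.
by rewrite -(subrK (f 0%N + g j - g 0%N) (f j.+1)) e; ring.
Qed.

(** Without its first row and column [toep n.+1] is [toep n]; if [y] starts with 0, its other
    entries form a kernel vector of that matrix. *)
Lemma toep_ker_tail n (y : 'cV_n.+1) : toep n \in unitmx ->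
  (forall i, i != 0 -> (toep n.+1 *m y) i 0 = 0) -> y 0 0 = 0 -> y = 0.
Proof.
move=> Tu Ty y0.
have : toep n *m (\col_(i < n) y (lift 0 i) 0) = 0.
  apply/matrixP => i j; rewrite (ord1 j) mxE [RHS]mxE.
  have := Ty (lift 0 i) isT; rewrite mxE big_ord_recl y0 mulr0 add0r.
  apply: etrans; apply: eq_bigr => k _; rewrite !mxE; congr (a _ * _).
  by rewrite /= !/bump /=; lia.
move=> /(congr1 (mulmx (invmx (toep n)))); rewrite mulKmx // mulmx0 => e.
apply/matrixP => i j; rewrite (ord1 j) [RHS]mxE.
case: (unliftP 0 i) => [k|] -> //.
by move/matrixP/(_ k 0): e; rewrite !mxE.
Qed.

Hypothesis al2 : forall n : nat, n.+1%:R + 2 * al != 0.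
Hypothesis a0 : a 0 != 0.

(** Induction on the size. A singular matrix with invertible predecessor would have all polynomial
    vectors in its image, and its left kernel vector [r] would be orthogonal to them. *)
Lemma toep_unit n : toep n \in unitmx.
Proof.
elim: n => [|n IH]; first by rewrite unitmxE det_mx00 unitr1.
rewrite unitmxE unitfE; apply/negP => /det0P [r r0 rT].
set v := r^T.
have Tv : toep n.+1 *m v = 0 by rewrite -(toep_sym n.+1) -trmx_mul rT trmx0.
have v0 : v 0 0 != 0.
  apply/eqP => v00; move/eqP: r0; apply; apply: trmx_inj; rewrite trmx0.
  by apply: (toep_ker_tail IH) => // i _; rewrite Tv mxE.
have cv (j : nat) : (j <= n)%N -> conv v j = 0.
  by move=> jn; rewrite -(toep_conv v (Ordinal (jn : (j < n.+1)%N))) Tv mxE.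
have Tk (j : nat) : (j <= n)%N -> conv (kmul v) j = conv (kmul v) 0%N.
  move=> jn; rewrite (@diff_eq (fun j : nat => conv (kmul v) j) (fun=> 0) n) //.
    by rewrite addr0 subr0.
  by move=> i ilt; rewrite conv_kmulS !cv ?(ltnW ilt) // !mulr0.
(* If the constant is 0, then [kmul v] is a kernel vector with first entry 0, hence 0. So [v] is a
   multiple of the first unit vector, and row 0 contradicts [a0]. *)
have [d0|d0] := eqVneq (conv (kmul v) 0%N) 0.
  have kv0 : kmul v = 0.
    apply: (toep_ker_tail IH); last by rewrite mxE mul0r.
    by move=> i _; rewrite toep_conv Tk ?d0 // -ltnS.
  have := cv 0%N isT; rewrite /conv big_ord_recl big1 /= => [|k _].
    by rewrite subr0 addr0 => /eqP; rewrite mulf_eq0 (negPf a0) (negPf v0).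
  move/matrixP/(_ (lift ord0 k) 0): kv0; rewrite !mxE => /eqP.
  by rewrite mulf_eq0 pnatr_eq0 /= => /eqP ->; rewrite mulr0.
have Im m : exists y : 'cV_n.+1,
    forall j : nat, (j <= n)%N -> conv y j = 'C(j, m)%:R.
  elim: m => [|m [y Ty]].
    exists ((conv (kmul v) 0%N)^-1 *: kmul v) => j jn; rewrite bin0.
    rewrite -(mulVf d0) -(Tk _ jn) /conv mulr_sumr; apply: eq_bigr => k _.
    by rewrite !mxE; ring.
  (* By Pascal's rule and [mul_bin_left], the increments of [conv (kmul y)] are those of a
     combination of two neighbouring binomial vectors. *)
  have e j : (j <= n)%N -> conv (kmul y) j = conv (kmul y) 0%N +
      ((m.+1%:R + 2 * al) * 'C(j, m.+1)%:R + (m%:R + al) * 'C(j, m)%:R) -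
      (m%:R + al) * 'C(0, m)%:R.
    move=> jn; rewrite (@diff_eq (fun j : nat => conv (kmul y) j)
      (fun j => (m.+1%:R + 2 * al) * 'C(j, m.+1)%:R + (m%:R + al) * 'C(j, m)%:R)
      n) //; first by rewrite bin0n mulr0 add0r.
    move=> {jn} {}j jn; rewrite conv_kmulS !Ty ?(ltnW jn) //.
    rewrite binS natrD.
    case: m {Ty} => [|m]; first by rewrite !bin0 bin1; ring.
    rewrite binS natrD.
    have := mul_bin_left j m => /(congr1 (fun x : nat => x%:R : F)).
    rewrite !natrM => e.
    have [mj|jm] := leqP m j.
      rewrite natrB // in e.
      rewrite -[m.+2%:R]natr1 -[m.+1%:R]natr1 in e *.
      suff : (m%:R + 1) * 'C(j, m.+1)%:R - (j%:R - m%:R) * 'C(j, m)%:R = 0 :> F.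
        move=> /(congr1 (fun x => - x)); rewrite oppr0 => e0.
        apply/eqP; rewrite -subr_eq0 -e0; apply/eqP; ring.
      by rewrite e subrr.
    by rewrite !bin_small; try lia; ring.
  (* This solves [e] for the next binomial vector: [al2] inverts the leading coefficient, and a
     multiple of [kmul v] removes the constant. *)
  exists (\col_(k < n.+1) (((m.+1%:R + 2 * al)^-1) * (kmul y k 0
     - (m%:R + al) * y k 0 -
     (conv (kmul y) 0%N - (m%:R + al) * 'C(0, m)%:R) *
       (conv (kmul v) 0%N)^-1 * kmul v k 0))) => j jn.
  apply: (mulfI (al2 m)).
  transitivity (conv (kmul y) j - (m%:R + al) * conv y j -
     (conv (kmul y) 0%N - (m%:R + al) * 'C(0, m)%:R) *
       (conv (kmul v) 0%N)^-1 * conv (kmul v) j).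
    rewrite /conv !mulr_sumr -!sumrB; apply: eq_bigr => k _; rewrite !mxE.
    by rewrite [LHS]mulrCA mulVKf //; ring.
  by rewrite Tk // -mulrA mulVf // e // Ty //; ring.
have rC m : \sum_j r 0 j * 'C(j, m)%:R = 0.
  have [y Ty] := Im m.
  have : (r *m (toep n.+1 *m y)) 0 0 = 0 by rewrite mulmxA rT mul0mx mxE.
  rewrite mxE; apply: etrans; apply: eq_bigr => k _.
  by rewrite toep_conv Ty // -ltnS.
(* Descending induction on [j]: ['C(i, j)] is 0 for [i < j] and 1 for [i = j], so [rC j] leaves
   [r 0 j] alone once the later entries vanish. *)
suff rj m : forall j : 'I_n.+1, (n - j <= m)%N -> r 0 j = 0.
  by move/eqP: r0; apply; apply/rowP => j; rewrite (rj n) ?mxE // leq_subr.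
elim/ltn_ind: m => m IHm j jm.
have := rC j; rewrite (bigD1 j) //= binn mulr1 big1 ?addr0 // => i ij.
have [ilt|ige] := ltnP i j; first by rewrite bin_small // mulr0.
have ji : (j < i)%N by rewrite ltn_neqAle ige eq_sym -val_eqE in ij *; rewrite ij.
rewrite (IHm (n - i)%N) ?mul0r //.
by apply: leq_trans jm; have := ltn_ord i; lia.
Qed.

End ToeplitzRecurrence.

(** * First column of the inverse Toeplitz matrix *)

Section Inverse.
Variables (F : numFieldType) (al : F) (a : int -> F).
Hypothesis a_rec : forall k : int,
  (k%:~R + 1 + al) * a (k + 1) = (k%:~R - al) * a k.
Hypothesis al1 : forall n : nat, n.+1%:R + al != 0.
Hypothesis al2 : forall n : nat, n.+1%:R + 2 * al != 0.
Hypothesis a0 : a 0 != 0.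

Let Tu n : toep a n \in unitmx := toep_unit a_rec al1 al2 a0 n.

Definition inv_col n : 'cV[F]_n.+1 := invmx (toep a n.+1) *m delta_mx 0 0.

Definition col_rev n (y : 'cV[F]_n) : 'cV[F]_n := \col_(k < n) y (rev_ord k) 0.

Lemma comb_revE n (y : 'cV[F]_n) p q i :
  (p *: y + (- q) *: col_rev y) i 0 = p * y i 0 - q * y (rev_ord i) 0.
Proof. by rewrite !mxE mulNr. Qed.

(** By [coef_sym], reversing rows and columns together leaves the matrix unchanged. *)
Lemma conv_rev n (y : 'cV[F]_n.+1) (j : nat) : (j <= n)%N ->
  conv a (col_rev y) j = conv a y (n - j)%N.
Proof.
move=> jn; rewrite /conv (reindex_inj rev_ord_inj); apply: eq_bigr => k _.
rewrite mxE rev_ordK; congr (_ * _).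
rewrite -[LHS](coef_sym a_rec al1).
congr (a _).
by rewrite /=; have := ltn_ord k; lia.
Qed.

Lemma conv_inj n (x y : 'cV[F]_n) :
  (forall j : nat, (j < n)%N -> conv a x j = conv a y j) -> x = y.
Proof.
move=> xy; have e : toep a n *m x = toep a n *m y.
  by apply/matrixP => i j; rewrite (ord1 j) !toep_conv xy.
by rewrite -(mulKmx (Tu n) x) e mulKmx.
Qed.

Lemma toep_inv_col n : toep a n.+1 *m inv_col n = delta_mx 0 0.
Proof. by rewrite mulKVmx. Qed.

Lemma conv_inv_col n (j : nat) : (j <= n)%N -> conv a (inv_col n) j = (j == 0%N)%:R.
Proof.
move=> jn; rewrite -(toep_conv a _ (Ordinal (jn : (j < n.+1)%N))).
by rewrite toep_inv_col mxE andbT.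
Qed.

Lemma conv_const_rev n (y : 'cV[F]_n.+1) :
  (forall j : nat, (j <= n)%N -> conv a y j = conv a y 0%N) -> y = col_rev y.
Proof.
move=> yc; apply: conv_inj => j jn.
by rewrite conv_rev // yc // yc ?leq_subr.
Qed.

(* [toep] maps [kmul u + al *: u], [u] the first column of the inverse, to a
   constant vector; hence this vector is invariant under reversal. *)
Lemma inv_col_last n :
  al * inv_col n 0 0 = (n%:R + al) * inv_col n ord_max 0.
Proof.
set u := inv_col n; set x := 1 *: kmul u + al *: u.
have convx j : conv a x j = conv a (kmul u) j + al * conv a u j.
  by rewrite conv_lin mul1r.
have cx (j : nat) : (j <= n)%N -> conv a x j = conv a x 0%N.
  move=> jn; rewrite (@diff_eq _ (fun j : nat => conv a x j) (fun=> 0) n) //.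
    by rewrite addr0 subr0.
  move=> i ilt; rewrite !convx.
  have := conv_kmulS a_rec u i => /(canRL (subrK _)) ->.
  rewrite !conv_inv_col ?(ltnW ilt) //=.
  (* The increment is 0 for [i > 0]; at [i = 0] the term of [kmul u] gives [al] and that of
     [al *: u] gives [- al]. *)
  by case: i {ilt} => [|i] /=; ring.
have xr : x = col_rev x := conv_const_rev cx.
have -> : al * u 0 0 = x 0 0 by rewrite !mxE /=; ring.
rewrite xr mxE (_ : rev_ord 0 = ord_max); first by rewrite !mxE; ring.
by apply: val_inj; rewrite /= subn1.
Qed.

(** With first entry 0 the column would vanish by [toep_ker_tail], yet its image is the first unit
    vector. *)
Lemma inv_col_head_neq0 n : inv_col n 0 0 != 0.
Proof.
apply/eqP => u0; have : inv_col n = 0.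
  apply: (toep_ker_tail (Tu n)) => // i i0.
  by rewrite toep_inv_col mxE (negPf i0).
move/(congr1 (mulmx (toep a n.+1))); rewrite toep_inv_col mulmx0.
by move/matrixP/(_ 0 0); rewrite !mxE => /eqP; rewrite oner_eq0.
Qed.

Lemma inv_col_head0 : inv_col 0 0 0 = (a 0)^-1.
Proof.
have := toep_inv_col 0 => /matrixP/(_ 0 0).
rewrite !mxE big_ord1 !mxE subrr => e.
by apply: (mulfI a0); rewrite divff.
Qed.

(** Levinson step: [p *: u - q *: col_rev u] has last entry 0, and the smaller matrix maps its
    truncation to [p] times the first unit vector. Comparing first entries relates [p ^+ 2 - q ^+ 2]
    to the smaller inverse. *)
Lemma inv_col_headS n :
  (n.+1%:R + al) ^+ 2 * inv_col n 0 0 =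
  n.+1%:R * (n.+1%:R + 2 * al) * inv_col n.+1 0 0.
Proof.
set u := inv_col n.+1; set p := u 0 0; set q := u ord_max 0.
have p0 : p != 0 := inv_col_head_neq0 n.+1.
have pq : al * p = (n.+1%:R + al) * q := inv_col_last n.+1.
set w := p *: u + (- q) *: col_rev u.
have wE i : w i 0 = p * u i 0 - q * u (rev_ord i) 0.
  by rewrite /w comb_revE.
have w_last : w ord_max 0 = 0.
  rewrite wE (_ : rev_ord ord_max = 0) -/p -/q; first by ring.
  by apply: val_inj; rewrite /= subnn.
have w_head : w 0 0 = p ^+ 2 - q ^+ 2.
  rewrite wE (_ : rev_ord 0 = ord_max) -/p -/q; first by ring.
  by apply: val_inj; rewrite /= subn1.
have e : \col_(i < n.+1) w (widen_ord (leqnSn n.+1) i) 0 = p *: inv_col n.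
  apply: conv_inj => j jn.
  transitivity (conv a w j).
    rewrite /conv [RHS]big_ord_recr /= w_last mulr0 addr0.
    by apply: eq_bigr => k _; rewrite [in LHS]mxE.
  rewrite conv_lin conv_rev ?(ltnW jn) // !conv_inv_col ?leq_subr ?(ltnW jn) //.
  rewrite subn_eq0 leqNgt jn mulr0 addr0.
  by rewrite convZ conv_inv_col.
move/matrixP/(_ 0 0): e; rewrite [LHS]mxE [RHS]mxE.
rewrite (_ : widen_ord _ _ = 0); last exact: val_inj.
rewrite w_head => e; apply: (mulfI p0); rewrite mulrCA -e.
(* [inv_col_last] eliminates [q], leaving [(n.+1%:R + al) ^+ 2 - al ^+ 2], which factors. *)
have -> : (n.+1%:R + al) ^+ 2 * (p ^+ 2 - q ^+ 2) =
  (n.+1%:R + al) ^+ 2 * p ^+ 2 - ((n.+1%:R + al) * q) ^+ 2 by ring.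
by rewrite -pq; ring.
Qed.

(** Reversal turns the equation for the first column of the inverse into that for the last. *)
Lemma toep_invE n (i : 'I_n.+1) :
  invmx (toep a n.+1) i 0 = inv_col n i 0 /\
  invmx (toep a n.+1) i ord_max = inv_col n (rev_ord i) 0.
Proof.
split; first by rewrite /inv_col -colE mxE.
have : toep a n.+1 *m col_rev (inv_col n) = delta_mx ord_max 0.
  apply/matrixP => j l; rewrite (ord1 l) toep_conv.
  have jn : (j <= n)%N by rewrite -ltnS.
  rewrite (conv_rev _ jn) (conv_inv_col (leq_subr j n)) mxE andbT -val_eqE /=.
  by congr (_%:R); have := ltn_ord j; lia.
move/(congr1 (mulmx (invmx (toep a n.+1)))); rewrite mulKmx // -colE.
by move/matrixP/(_ i 0); rewrite [LHS]mxE [RHS]mxE.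
Qed.

End Inverse.

(** * Corner perturbations of determinants *)

(** Sylvester's identity: the two orders of one product of block matrices are both block triangular,
    with these determinants. *)
Lemma det_1_addmx_mul (R : comNzRingType) m n (A : 'M[R]_(m, n)) (B : 'M[R]_(n, m)) :
  \det (1%:M + A *m B) = \det (1%:M + B *m A).
Proof.
have e1 : block_mx 1%:M (- A) B 1%:M *m block_mx 1%:M A 0 1%:M =
    block_mx 1%:M 0 B (1%:M + B *m A).
  by rewrite mulmx_block !mul1mx !mulmx1 !mulmx0 !addr0 addrN addrC.
have e2 : block_mx 1%:M A 0 1%:M *m block_mx 1%:M (- A) B 1%:M =
    block_mx (1%:M + A *m B) 0 B 1%:M.
  by rewrite mulmx_block !mul1mx !mulmx1 !mul0mx !add0r addNr.
move/(congr1 determinant): e1; move/(congr1 determinant): e2.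
rewrite !det_mulmx !det_lblock !det_ublock !det1 !mul1r !mulr1.
by move=> <- <-.
Qed.

Lemma det_mx2 (R : comNzRingType) (a b c d : R) :
  \det (mx2 a b c d) = a * d - b * c.
Proof.
rewrite (expand_det_row _ ord0) !big_ord_recl big_ord0 addr0 /cofactor !det_mx11.
rewrite !mxE /= /bump /=; ring.
Qed.

(** The perturbation factors through the first and last unit vectors, the columns of [U], so
    Sylvester's identity reduces the ratio to a determinant of size 2. *)
Lemma det_add_corner (F : fieldType) n (T : 'M[F]_n.+2) (a b c d : F) :
  T \in unitmx ->
  let S := invmx T in
  \det (T + corner_mx a b c d n.+2) / \det T =
  \det (1%:M + mx2 (S 0 0) (S 0 ord_max) (S ord_max 0) (S ord_max ord_max) *m
    mx2 a b c d).
Proof.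
move=> Tu S.
pose s (k : 'I_2) : 'I_n.+2 := if k == 0 then 0 else ord_max.
pose U : 'M[F]_(n.+2, 2) := \matrix_(i, k) (i == s k)%:R.
have corner : corner_mx a b c d n.+2 = U *m mx2 a b c d *m U^T.
  apply/matrixP => i j; rewrite !mxE !big_ord_recl big_ord0 !mxE.
  rewrite !big_ord_recl !big_ord0 !mxE /s /= /bump /= -!val_eqE /=.
  case: (eqVneq (i : nat) 0%N) => [->|_] /=;
   case: (eqVneq (j : nat) 0%N) => [->|_] /=; rewrite ?eqxx /=;
   try case: (eqVneq (i : nat) n.+1) => [_|_] /=;
   try case: (eqVneq (j : nat) n.+1) => [_|_] /=; rewrite /=; ring.
have mid : U^T *m S *m U =
    mx2 (S 0 0) (S 0 ord_max) (S ord_max 0) (S ord_max ord_max).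
  have Us (A : 'M[F]_(2, n.+2)) k l : (A *m U) k l = A k (s l).
    rewrite mxE (bigD1 (s l)) //= big1 => [|i /negPf il].
      by rewrite mxE eqxx mulr1 addr0.
    by rewrite mxE il mulr0.
  have sU (A : 'M[F]_n.+2) k l : (U^T *m A) k l = A (s k) l.
    rewrite mxE (bigD1 (s k)) //= big1 => [|i /negPf il].
      by rewrite !mxE eqxx mul1r addr0.
    by rewrite !mxE il mul0r.
  apply/matrixP => k l; rewrite Us sU mxE /s -!val_eqE /=.
  by case: ifP; case: ifP.
have -> : T + corner_mx a b c d n.+2 =
    T *m (1%:M + (S *m U *m mx2 a b c d) *m U^T).
  by rewrite mulmxDr mulmx1 corner !mulmxA mulmxV ?mul1mx.
rewrite det_mulmx mulrC mulKf; last by move: Tu; rewrite unitmxE unitfE.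
by rewrite det_1_addmx_mul !mulmxA mid.
Qed.

(** * Complex powers and componentwise derivatives *)

Section Cpowers.
Variable R : realType.
Implicit Types (z b : R[i]) (l x y : R).

Lemma CexpD z1 z2 : Cexp (z1 + z2) = Cexp z1 * Cexp z2.
Proof.
case: z1 => a b; case: z2 => c d; rewrite /Cexp /expi /= expRD cosD sinD.
by simpc; congr (_ +i* _); ring.
Qed.

Lemma normc_Cexp z : normc (Cexp z) = expR (complex.Re z).
Proof.
case: z => a b; rewrite /Cexp /expi /=; simpc; rewrite /=.
by rewrite !exprMn -mulrDr cos2Dsin2 mulr1 sqrtr_sqr ger0_norm // expR_ge0.
Qed.

(* [Epow b (ln u)] is the power [u ^ b] of a positive real [u]. *)
Definition Epow b l : R[i] := Cexp (b * l%:C).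

Lemma EpowD b l1 l2 : Epow b (l1 + l2) = Epow b l1 * Epow b l2.
Proof. by rewrite /Epow rmorphD mulrDr CexpD. Qed.

Lemma EpowDl b1 b2 l : Epow (b1 + b2) l = Epow b1 l * Epow b2 l.
Proof. by rewrite /Epow mulrDl CexpD. Qed.

Lemma normc_Epow b l : normc (Epow b l) = expR (complex.Re b * l).
Proof. by rewrite normc_Cexp; case: b => ? ?; simpc. Qed.

Lemma Cexp0 : Cexp (0 : R[i]) = 1.
Proof. by rewrite /Cexp /expi /= expR0 cos0 sin0; simpc. Qed.

Lemma Epow0 b : Epow b 0 = 1.
Proof. by rewrite /Epow mulr0 Cexp0. Qed.

Lemma Epow0l l : Epow 0 l = 1.
Proof. by rewrite /Epow mul0r Cexp0. Qed.

Lemma Epow1 l : Epow 1 l = (expR l)%:C.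
Proof. by rewrite /Epow mul1r /Cexp /expi /= cos0 sin0; simpc. Qed.

Lemma Epow_nat n l : 0 < l -> Epow n%:R (ln l) = (l ^+ n)%:C.
Proof.
move=> l0; elim: n => [|n IH]; first by rewrite Epow0l.
by rewrite -natr1 EpowDl IH Epow1 lnK // exprSr rmorphM.
Qed.

Lemma Epow_neq0 b l : Epow b l != 0.
Proof.
apply/eqP => /(congr1 (@Normc.normc R)); rewrite normc_Epow normc0.
by apply/eqP; rewrite gt_eqF // expR_gt0.
Qed.

Lemma EpowN b l : Epow b (- l) = (Epow b l)^-1.
Proof.
apply: (mulfI (Epow_neq0 b l)).
by rewrite -EpowD subrr Epow0 divff // Epow_neq0.
Qed.

Lemma expi_Epow x : expi x = Epow 'i%C x.
Proof. by rewrite /Epow /Cexp /=; simpc => /=; rewrite expR0; simpc. Qed.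

Definition is_cderive (G : R -> R[i]) x (G' : R[i]) :=
  is_derive x 1 (fun y => complex.Re (G y)) (complex.Re G') /\
  is_derive x 1 (fun y => complex.Im (G y)) (complex.Im G').

Lemma is_cderive_cst c x : is_cderive (fun=> c) x 0.
Proof. by split; apply: is_derive_cst. Qed.

Lemma is_cderive_real (g : R -> R) x g' :
  is_derive x 1 g g' -> is_cderive (fun y => (g y)%:C) x g'%:C.
Proof. by move=> dg; split => //=; apply: is_derive_cst. Qed.

Lemma is_cderiveD F G x F' G' : is_cderive F x F' -> is_cderive G x G' ->
  is_cderive (fun y => F y + G y) x (F' + G').
Proof.
move=> [F1 F2] [G1 G2]; split.
  rewrite (_ : (fun _ => _) =
    (fun y => complex.Re (F y)) \+ (fun y => complex.Re (G y))); last first.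
    by apply/funext => y /=; case: (F y) (G y) => ? ? [].
  by apply: is_derive_eq; case: F' G' {F1 F2 G1 G2} => ? ? [].
rewrite (_ : (fun _ => _) =
  (fun y => complex.Im (F y)) \+ (fun y => complex.Im (G y))); last first.
  by apply/funext => y /=; case: (F y) (G y) => ? ? [].
by apply: is_derive_eq; case: F' G' {F1 F2 G1 G2} => ? ? [].
Qed.

Lemma is_cderiveM F G x F' G' : is_cderive F x F' -> is_cderive G x G' ->
  is_cderive (fun y => F y * G y) x (F' * G x + F x * G').
Proof.
move=> [F1 F2] [G1 G2]; split.
  rewrite (_ : (fun _ => _) =
    (fun y => complex.Re (F y)) * (fun y => complex.Re (G y)) -
    (fun y => complex.Im (F y)) * (fun y => complex.Im (G y))); last first.
    by apply/funext => y /=; rewrite !fctE; case: (F y) (G y) => ? ? [].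
  apply: (is_derive_eq (is_deriveB (is_deriveM F1 G1) (is_deriveM F2 G2))).
  rewrite /GRing.scale /=.
  by case: F' G' (F x) (G x) {F1 F2 G1 G2} => ? ? [? ?] [? ?] [? ?] /=; ring.
rewrite (_ : (fun _ => _) =
  (fun y => complex.Re (F y)) * (fun y => complex.Im (G y)) +
  (fun y => complex.Im (F y)) * (fun y => complex.Re (G y))); last first.
  by apply/funext => y /=; rewrite !fctE; case: (F y) (G y) => ? ? [].
apply: (is_derive_eq (is_deriveD (is_deriveM F1 G2) (is_deriveM F2 G1))).
rewrite /GRing.scale /=.
by case: F' G' (F x) (G x) {F1 F2 G1 G2} => ? ? [? ?] [? ?] [? ?] /=; ring.
Qed.

Lemma is_cderive_eq G x G' G'' :
  is_cderive G x G' -> G' = G'' -> is_cderive G x G''.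
Proof. by move=> ? <-. Qed.

Lemma is_cderive_expi (g : R -> R) x g' : is_derive x 1 g g' ->
  is_cderive (fun y => expi (g y)) x (g'%:C * 'i%C * expi (g x)).
Proof.
move=> dg; split; rewrite /=.
  by apply: is_derive_eq; simpc => /=; rewrite /GRing.scale /=; ring.
by apply: is_derive_eq; simpc => /=; rewrite /GRing.scale /=; ring.
Qed.

Lemma is_cderive_Epow b (g : R -> R) x g' : is_derive x 1 g g' ->
  is_cderive (fun y => Epow b (g y)) x (b * g'%:C * Epow b (g x)).
Proof.
move=> dg; case: b => s t.
have -> : (fun y => Epow (s +i* t) (g y)) =
   (fun y => (expR (s * g y))%:C * expi (t * g y)).
  by apply/funext => y; rewrite /Epow /Cexp; simpc.
apply: is_cderive_eq.
  apply: is_cderiveM.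
    by apply: is_cderive_real.
  by apply: is_cderive_expi.
rewrite /Epow /Cexp /expi; simpc; rewrite /= /GRing.scale /=.
by congr (_ +i* _); ring.
Qed.


(** Both [k + g] and [k - g] have a nonnegative derivative. *)
Lemma is_derive_le_incr (g k g' k' : R -> R) u v : u <= v ->
  (forall x, x \in `[u, v] -> is_derive x 1 g (g' x)) ->
  (forall x, x \in `[u, v] -> is_derive x 1 k (k' x)) ->
  (forall x, x \in `[u, v] -> `|g' x| <= k' x) ->
  `|g v - g u| <= k v - k u.
Proof.
move=> uv dg dk gk.
have incr (h h' : R -> R) : (forall x, x \in `[u, v] -> is_derive x 1 h (h' x)) ->
    (forall x, x \in `[u, v] -> 0 <= h' x) -> h u <= h v.
  move=> dh h0.
  have sub x : x \in `]u, v[ -> x \in `[u, v] by apply: subset_itv_oo_cc.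
  apply: (@ger0_derive1_le_cc _ h u v) => //.
  - by move=> x /sub xi; have [] := dh x xi.
  - by move=> x /sub xi; rewrite derive1E; have := dh x xi; case=> _ ->; exact: h0.
  - by apply: derivable_within_continuous => x xi; have [] := dh x xi.
  - by rewrite in_itv /= lexx uv.
  - by rewrite in_itv /= lexx uv.
rewrite ler_norml; apply/andP; split.
  have := @incr (k + g) (fun x => k' x + g' x); rewrite !fctE => H.
  have : k u + g u <= k v + g v.
    apply: H => x xi; first by have := dg x xi; have := dk x xi; exact: is_deriveD.
    by have := gk x xi; rewrite ler_norml => /andP[]; lra.
  by lra.
have := @incr (k - g) (fun x => k' x - g' x); rewrite !fctE => H.
have : k u - g u <= k v - g v.
  apply: H => x xi; first by have := dg x xi; have := dk x xi; exact: is_deriveB.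
  by have := gk x xi; rewrite ler_norml => /andP[]; lra.
by lra.
Qed.

Lemma normc_ReIm (z : R[i]) : normc z <= `|complex.Re z| + `|complex.Im z|.
Proof.
case: z => x y /=; rewrite -[leRHS]ger0_norm ?addr_ge0 //.
rewrite -sqrtr_sqr ler_wsqrtr // sqrrD !real_normK ?num_real //.
by rewrite lerD2r lerDl mulrn_wge0 // mulr_ge0.
Qed.

Lemma normRe (z : R[i]) : `|complex.Re z| <= normc z.
Proof.
by case: z => x y /=; rewrite -sqrtr_sqr ler_wsqrtr // lerDl sqr_ge0.
Qed.

Lemma normIm (z : R[i]) : `|complex.Im z| <= normc z.
Proof.
by case: z => x y /=; rewrite -sqrtr_sqr ler_wsqrtr // lerDr sqr_ge0.
Qed.

(** The factor 2 comes from estimating real and imaginary parts separately. *)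
Lemma is_cderive_le_incr (G G' : R -> R[i]) (k k' : R -> R) u v : u <= v ->
  (forall x, x \in `[u, v] -> is_cderive G x (G' x)) ->
  (forall x, x \in `[u, v] -> is_derive x 1 k (k' x)) ->
  (forall x, x \in `[u, v] -> normc (G' x) <= k' x) ->
  normc (G v - G u) <= 2 * (k v - k u).
Proof.
move=> uv dG dk Gk; apply: le_trans (normc_ReIm _) _.
have -> : complex.Re (G v - G u) = complex.Re (G v) - complex.Re (G u).
  by case: (G v) (G u) => ? ? [].
have -> : complex.Im (G v - G u) = complex.Im (G v) - complex.Im (G u).
  by case: (G v) (G u) => ? ? [].
rewrite mulr_natl mulr2n lerD //.
  apply: (is_derive_le_incr (g := fun x => complex.Re (G x))
    (g' := fun x => complex.Re (G' x)) (k' := k')) => // x xi.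
    by have [] := dG x xi.
  exact: le_trans (normRe _) (Gk x xi).
apply: (is_derive_le_incr (g := fun x => complex.Im (G x))
  (g' := fun x => complex.Im (G' x)) (k' := k')) => // x xi.
  by have [] := dG x xi.
exact: le_trans (normIm _) (Gk x xi).
Qed.

Lemma normc_real x : normc (x%:C) = `|x|.
Proof. by rewrite /= expr0n /= addr0 sqrtr_sqr. Qed.

Lemma normc_ge0 z : 0 <= normc z.
Proof. by case: z => ? ?; exact: sqrtr_ge0. Qed.

(** For [x <= 0] the derivative [b * Epow b x] has norm at most [normc b * expR (- x)], because
    [complex.Re b >= -1]. *)
Lemma normc_Epow_sub1 b l : -1 <= complex.Re b -> l <= 0 ->
  normc (Epow b l - 1) <= 2 * normc b * (expR (- l) - 1).
Proof.
move=> b1 l0; rewrite -(Epow0 b) -opprB normcN.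
have := @is_cderive_le_incr (Epow b) (fun x => b * Epow b x)
  (fun x => - normc b * expR (- x)) (fun x => normc b * expR (- x)) l 0 l0.
rewrite oppr0 expR0 mulr1 => H; apply: le_trans (H _ _ _) _.
- move=> x _; apply: is_cderive_eq.
    exact: (@is_cderive_Epow b id x 1 (is_derive_id x 1)).
  by rewrite mulr1.
- by move=> x _; apply: is_derive_eq; rewrite /GRing.scale /=; ring.
- move=> x; rewrite in_itv /= => /andP[_ x0].
  rewrite normcM normc_Epow.
  rewrite ler_wpM2l ?normc_ge0 // ler_expR.
  have : 0 <= (complex.Re b + 1) * - x by apply: mulr_ge0; lra.
  nra.
- by lra.
Qed.

End Cpowers.

(** * Asymptotics of products and of the corner entries *)

Section ProductBound.
Variable R : realType.

Lemma normc_prod_sub1 (c : nat -> R[i]) (d : R) k : 0 <= d ->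
  (forall i, (i < k)%N -> normc (c i - 1) <= d) -> k%:R * d <= 2^-1 ->
  normc (\prod_(i < k) c i - 1) <= 2 * (k%:R * d).
Proof.
move=> d0; elim: k => [|k IH] cd kd.
  by rewrite big_ord0 subrr normc0 mul0r mulr0.
rewrite big_ord_recr /=; set P := \prod_(i < k) c i.
have -> : P * c k - 1 = (P - 1) * (c k - 1) + ((P - 1) + (c k - 1)) by ring.
apply: le_trans (le_normcD _ _) _; rewrite normcM.
have {}IH : normc (P - 1) <= 2 * (k%:R * d).
  apply: IH => [i ik|]; first by apply: cd; exact: leq_trans ik _.
  by apply: le_trans kd; rewrite ler_wpM2r // ler_nat.
have ck := cd k (ltnSn k).
have := le_normcD (P - 1) (c k - 1).
have n1 := normc_ge0 (P - 1); have n2 := normc_ge0 (c k - 1).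
rewrite -natr1 in kd *.
(* The smallness of [k%:R * d] gives [normc (P - 1) <= 1], so the cross term costs only one more
   [d]. *)
have : normc (P - 1) * normc (c k - 1) <= 1 * d.
  by apply: ler_pM => //; lra.
lra.
Qed.

Lemma ln_onem_ge (x : R) : 0 <= x <= 2^-1 -> -1 <= ln (1 - x) <= 0.
Proof.
move=> /andP[x0 x1]; apply/andP; split; last by rewrite ln_le0 //; lra.
have e2 : 2 <= expR (1 : R) by have := expR_ge1Dx (1 : R); lra.
rewrite -[X in X <= _](expRK) ler_ln ?posrE ?expR_gt0 //; last by lra.
rewrite expRN; apply: (@le_trans _ _ 2^-1); last by lra.
by rewrite lef_pV2 // posrE ?expR_gt0.
Qed.

(** The first-order terms of [(1 + b h) (1 - h) ^ b] cancel: its derivative is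
    [- b (1 + b) h (1 - h) ^ (b - 1)]. *)
Lemma factor_sub1 (b : R[i]) : exists2 K : R, 0 <= K & forall h : R,
  0 <= h <= 2^-1 ->
  normc ((1 + b * h%:C) * Epow b (ln (1 - h)) - 1) <= K * h ^+ 2.
Proof.
(* The factor 2 bounds [1 / (1 - x)], and the exponential bounds [(1 - x) ^ b], since [ln (1 - x)]
   lies between -1 and 0. *)
pose K := normc b * normc (1 + b) * 2 * expR `|complex.Re b|.
have K0 : 0 <= K by rewrite !mulr_ge0 ?normc_ge0 ?expR_ge0.
exists K => // h /andP[h0 h1].
pose G x := (1 + b * x%:C) * Epow b (ln (1 - x)).
pose G' x := - b * (1 + b) * (x / (1 - x))%:C * Epow b (ln (1 - x)).
have G0 : G 0 = 1 by rewrite /G mulr0 addr0 subr0 ln1 Epow0 mul1r.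
rewrite -/(G h) -{1}G0.
have := @is_cderive_le_incr R G G' (fun x => K / 2 * x ^+ 2) (fun x => K * x) 0 h h0.
rewrite expr0n /= mulr0 subr0 mulrA [2 * _]mulrC divfK ?pnatr_eq0 //; apply.
- move=> x; rewrite in_itv /= => /andP[x0 xh].
  have x1 : 0 < 1 - x by lra.
  apply: is_cderive_eq.
    apply: is_cderiveM.
      apply: is_cderiveD; first exact: is_cderive_cst.
      apply: is_cderiveM; first exact: is_cderive_cst.
      exact: (@is_cderive_real _ id x 1 (is_derive_id x 1)).
    apply: is_cderive_Epow.
    apply: (@is_derive1_comp _ (@ln R) (fun x => 1 - x) x); exact: is_derive1_ln.
  rewrite /G' add0r mul0r add0r mulr1.
  have -> : (x / (1 - x)) = (1 - x)^-1 - 1 by field; rewrite gt_eqF.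
  rewrite /GRing.scale /= !rmorphM /= rmorphB /=.
  have -> : x%:C = 1 - (1 - x)%:C by rewrite rmorphB /= opprB addrC subrK.
  have uv : (1 - x)%:C * ((1 - x)^-1)%:C = 1 :> R[i].
    by rewrite -rmorphM /= mulfV // gt_eqF.
  rewrite add0r rmorphN rmorph1 /=.
  move: ((1 - x)%:C) (((1 - x)^-1)%:C) (Epow b _) uv => u v E uv.
  have -> : forall z, b * E + (1 + b * (1 - u)) * (b * (v * (1 * z)) * E) =
    b * E + (1 + b) * b * v * z * E - b ^+ 2 * (u * v) * z * E.
    by move=> z; ring.
  by rewrite uv; ring.
- by move=> x _; apply: is_derive_eq; rewrite /GRing.scale /=; field.
- move=> x; rewrite in_itv /= => /andP[x0 xh].
  rewrite /G' normcM normc_Epow !normcM normcN normc_real.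
  have /andP[l1 l0] : -1 <= ln (1 - x) <= 0 by apply: ln_onem_ge; apply/andP; split; lra.
  have -> : K * x = normc b * normc (1 + b) * (2 * x) * expR `|complex.Re b|.
    by rewrite /K; ring.
  apply: ler_pM; rewrite ?mulr_ge0 ?normc_ge0 ?expR_ge0 //.
    rewrite ler_wpM2l ?mulr_ge0 ?normc_ge0 //.
    rewrite ger0_norm ?divr_ge0 //; last by lra.
    by rewrite ler_pdivrMr; nra.
  rewrite ler_expR; apply: le_trans (ler_norm _) _; rewrite normrM.
  by rewrite ler_piMr // ler0_norm //; lra.
Qed.

(** Multiplying the factor [1 + b / j] by [(1 - 1 / j) ^ b] brings it within [K / m ^ 2] of 1, and
    the correcting powers telescope to [2 ^ (- b)]. *)
Lemma prod_ratio_bound (b : R[i]) : exists2 K : R, 0 <= K &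
  exists N, forall m, (N <= m)%N ->
  normc (\prod_(i < m) (1 + b / (m + i).+1%:R) / Epow b (ln 2) - 1) <= K / m%:R.
Proof.
have [K K0 HK] := factor_sub1 b.
exists (2 * K); first by rewrite mulr_ge0.
have [N HN] : exists N : nat, 2 * K < N%:R.
  have := archi_boundP (mulr_ge0 (ler0n R 2) K0) => h.
  by exists (Num.bound (2 * K)).
exists N.+1 => m Nm.
have m0 : 0 < m%:R :> R by rewrite ltr0n; case: m Nm.
pose h i : R := (m + i).+1%:R^-1.
pose c i := (1 + b * (h i)%:C) * Epow b (ln (1 - h i)).
have tele k : \prod_(i < k) (1 + b / (m + i).+1%:R) =
    \prod_(i < k) c i * Epow b (ln ((m + k)%:R / m%:R)).
  elim: k => [|k IH].
    by rewrite !big_ord0 addn0 divff ?gt_eqF // ln1 Epow0 mulr1.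
  rewrite !big_ord_recr /= IH /c.
  have -> : (h k)%:C = (m + k).+1%:R^-1 :> R[i].
    by rewrite /h fmorphV rmorph_nat.
  have e : ln ((m + k.+1)%:R / m%:R) =
      ln ((m + k)%:R / m%:R) - ln (1 - h k).
    rewrite -ln_div ?posrE.
    - congr ln; rewrite /h addnS -natr1.
      have mk0 : 0 < (m + k)%:R :> R by rewrite natrD; apply: ltr_wpDr.
      by field; rewrite !gt_eqF //=; lra.
    - by rewrite divr_gt0 // natrD; apply: ltr_wpDr.
    - rewrite subr_gt0 /h invf_lt1 ?ltr0n // ltr1n.
      lia.
  rewrite e EpowD EpowN; field.
  by rewrite Epow_neq0 -natrD addrC natr1 pnatr_eq0.
have m2 : (m + m)%:R / m%:R = 2 :> R by rewrite natrD; field; rewrite gt_eqF.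
rewrite tele m2.
rewrite mulfK ?Epow_neq0 //.
have md : m%:R * (K / m%:R ^+ 2) = K / m%:R by field; rewrite gt_eqF.
rewrite -mulrA -md; apply: normc_prod_sub1.
- by rewrite divr_ge0 // exprn_ge0 // ltW.
- move=> i im; apply: le_trans (HK _ _) _.
    rewrite /h invr_ge0 ler0n /= lef_pV2 ?posrE ?ltr0n // (ler_nat _ 2).
    lia.
  rewrite ler_wpM2l // /h exprVn lef_pV2 ?posrE ?exprn_gt0 ?ltr0n //.
    by rewrite lerXn2r ?nnegrE ?ler0n // ler_nat; lia.
  lia.
- rewrite md ler_pdivrMr //.
  have : N.+1%:R <= m%:R :> R by rewrite ler_nat.
  by rewrite -natr1; lra.
Qed.

End ProductBound.

(** * Asymptotic orders of complex sequences *)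

Section BigO.
Variable R : realType.
Implicit Types f g : nat -> R[i].

(* [isO k f] means [f n = O(1 / (n + 1) ^ k)]: the index [n] is the last one of
   a matrix of size [n + 1]. *)
Definition isO k f := exists K : R, exists N : nat, forall n, (N <= n)%N ->
  normc (f n) <= K / n.+1%:R ^+ k.

Lemma isO_ext k f g : (exists N, forall n, (N <= n)%N -> f n = g n) ->
  isO k f -> isO k g.
Proof.
move=> [N fg] [K [N' H]]; exists K, (maxn N N') => n.
by rewrite geq_max => /andP[n1 n2]; rewrite -fg // H.
Qed.

Lemma isOD k f g : isO k f -> isO k g -> isO k (fun n => f n + g n).
Proof.
move=> [K [N H]] [K' [N' H']]; exists (K + K'), (maxn N N') => n.
rewrite geq_max => /andP[n1 n2]; apply: le_trans (le_normcD _ _) _.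
by rewrite mulrDl lerD ?H ?H'.
Qed.

Lemma isOM j k f g : isO j f -> isO k g -> isO (j + k) (fun n => f n * g n).
Proof.
move=> [K [N H]] [K' [N' H']]; exists (K * K'), (maxn N N') => n.
rewrite geq_max => /andP[n1 n2]; rewrite normcM exprD invfM mulrACA.
by apply: ler_pM; rewrite ?normc_ge0 ?H ?H'.
Qed.

Lemma isO_cst c : isO 0 (fun=> c).
Proof. by exists (normc c), 0%N => n _; rewrite expr0 divr1. Qed.

Lemma isOMc k c f : isO k f -> isO k (fun n => c * f n).
Proof. exact: (isOM (isO_cst c)). Qed.

Lemma isO_weak k f : isO k.+1 f -> isO k f.
Proof.
move=> [K [N H]]; exists K, N => n /H {}H; apply: (le_trans H).
have [K0|K0] := leP 0 K; last first.
  have := le_trans (normc_ge0 _) H; rewrite pmulr_lge0 ?invr_gt0 ?exprn_gt0 //.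
  by rewrite leNgt K0.
rewrite ler_wpM2l // lef_pV2 ?posrE ?exprn_gt0 //.
by rewrite exprS ler_peMl ?exprn_ge0 // ler1n.
Qed.

Lemma normc_natr n : normc (n%:R : R[i]) = n%:R.
Proof. by rewrite -(rmorph_nat (real_complex R)) normc_real normr_nat. Qed.

Lemma natr_add_norm (c : R[i]) : exists N, forall n, (N <= n)%N ->
  n.+1%:R / 2 <= normc (n.+1%:R + c).
Proof.
have c0 : 0 <= 2 * normc c by rewrite mulr_ge0 ?normc_ge0.
exists (Num.bound (2 * normc c)) => n Nn.
have := le_normcD (n.+1%:R + c) (- c); rewrite addrK normcN normc_natr.
have := archi_boundP c0.
have : (Num.bound (2 * normc c))%:R <= n%:R :> R by rewrite ler_nat.
have e : n.+1%:R = n%:R + 1 :> R by rewrite natr1.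
by rewrite e; lra.
Qed.

Lemma natr_add_neq0 (c : R[i]) : exists N, forall n, (N <= n)%N ->
  n.+1%:R + c != 0.
Proof.
have [N H] := natr_add_norm c; exists N => n /H {}H.
apply/eqP => e; move: H; rewrite e normc0 leNgt; apply/negP.
by rewrite negbK divr_gt0.
Qed.

Lemma isO_inv c : isO 1 (fun n => (n.+1%:R + c)^-1).
Proof.
have [N H] := natr_add_norm c; exists 2, N => n /H {}H.
rewrite normcV expr1 -invf_div lef_pV2 ?posrE ?divr_gt0 //.
by apply: lt_le_trans H; rewrite divr_gt0.
Qed.

Lemma isO_inv_nat : isO 1 (fun n => n.+1%:R^-1).
Proof.
apply: isO_ext (isO_inv 0); exists 0%N => n _; by rewrite addr0.
Qed.

Lemma isO_invf f : isO 1 (fun n => f n - 1) ->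
  (exists N, forall n, (N <= n)%N -> f n != 0) /\ isO 0 (fun n => (f n)^-1).
Proof.
move=> [K [N H]].
suff h : exists N', forall n, (N' <= n)%N -> 2^-1 <= normc (f n).
  have [N' {}h] := h; split.
    exists N' => n /h {}h; apply/eqP => e; move: h; rewrite e normc0; lra.
  exists 2, N' => n /h {}h; rewrite normcV expr0 divr1 -[leRHS]invrK.
  by rewrite lef_pV2 ?posrE //; apply: lt_le_trans h.
exists (maxn N (Num.bound (2 * `|K|))) => n; rewrite geq_max => /andP[n1 n2].
have := H n n1; rewrite expr1 ler_pdivlMr // -(natr1 n : _ = _ :> R) => {}H.
have := archi_boundP (mulr_ge0 (ler0n R 2) (normr_ge0 K)).
have : (Num.bound (2 * `|K|))%:R <= n%:R :> R by rewrite ler_nat.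
have := le_normcD (f n) (- (f n - 1)); rewrite normcN opprB addrCA subrr addr0.
rewrite normc1 => h1 h2 h3; have := ler_norm K => h4.
have n0 : 0 <= n%:R :> R by [].
suff : normc (f n - 1) <= 2^-1 by lra.
rewrite -(@ler_pM2r _ (n%:R + 1)); last by lra.
by apply: le_trans H _; lra.
Qed.

(** The first hypothesis gives the limit 0, so [f n] is minus the sum of the later increments, a
    tail of a series with terms of order 3. *)
Lemma isO_telescope f : isO 1 f -> isO 3 (fun n => f n.+1 - f n) -> isO 2 f.
Proof.
move=> [K1 [N1 H1]] [K [N H]].
(* Comparison sequence: [1 / x ^ 3] is at most twice [1 / x ^ 2 - 1 / (x + 1) ^ 2] for [x >= 1]. *)
pose u n : R := (n.+1%:R ^+ 2)^-1.
have K0 : 0 <= K.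
  have := le_trans (normc_ge0 _) (H N (leqnn N)).
  by rewrite pmulr_lge0 // invr_gt0 exprn_gt0.
have step n : (N <= n)%N -> normc (f n.+1 - f n) <= 2 * K * (u n - u n.+1).
  move=> /H {}H; apply: le_trans H _.
  rewrite [2 * K]mulrC -mulrA ler_wpM2l // /u -[n.+2%:R]natr1.
  have : 1 <= n.+1%:R :> R by rewrite ler1n.
  move: (n.+1%:R) => x x1.
  rewrite -subr_ge0.
  have -> : 2 * ((x ^+ 2)^-1 - ((x + 1) ^+ 2)^-1) - (x ^+ 3)^-1 =
     (3 * x ^+ 2 - 1) / (x ^+ 3 * (x + 1) ^+ 2).
    by field; rewrite !gt_eqF //; lra.
  by rewrite divr_ge0 ?mulr_ge0 ?exprn_ge0 //; nra.
have tele n k : (N <= n)%N -> normc (f (n + k)%N - f n) <= 2 * K * (u n - u (n + k)%N).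
  move=> Nn; elim: k => [|k IH].
    by rewrite addn0 !subrr normc0 mulr0.
  rewrite addnS; have -> : f (n + k).+1 - f n =
    (f (n + k).+1 - f (n + k)%N) + (f (n + k)%N - f n) by ring.
  apply: le_trans (le_normcD _ _) _.
  have := step (n + k)%N (leq_trans Nn (leq_addr k n)).
  by nra.
exists (2 * K + 1), (maxn N N1) => n; rewrite geq_max => /andP[n1 n2].
have u0 m : 0 < u m by rewrite invr_gt0 exprn_gt0.
(* So far out, the first-order bound on [f (n + k)] is already below [u n]. *)
pose k := Num.bound (`|K1| / u n).
have hk : `|K1| / u n < k%:R.
  by apply: archi_boundP; rewrite divr_ge0 // ltW.
have := tele n k n1; have := H1 (n + k)%N (leq_trans n2 (leq_addr k n)).
have := le_normcD (f (n + k)%N) (- (f (n + k)%N - f n)).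
rewrite normcN opprB addrCA subrr addr0 => h1 h2 h3.
apply: le_trans h1 _; rewrite mulrDl mul1r -/(u n) [leRHS]addrC.
apply: lerD; last first.
  apply: le_trans h3 _; rewrite ler_wpM2l ?mulr_ge0 //.
  by have := u0 (n + k)%N; lra.
apply: le_trans h2 _; rewrite expr1 ler_pdivrMr //.
move: hk; rewrite ltr_pdivrMr // => hk.
apply: le_trans (ler_norm _) _; apply: le_trans (ltW hk) _.
by rewrite mulrC ler_wpM2l ?(ltW (u0 n)) // ler_nat; lia.
Qed.

End BigO.

(** * Expansion of the corner entries of the inverse *)

Section CornerAsymptotics.
Variables (R : realType) (al : R[i]) (p q : nat -> R[i]).
Hypothesis al1 : forall n : nat, n.+1%:R + al != 0.
Hypothesis al2 : forall n : nat, n.+1%:R + 2 * al != 0.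
Hypothesis p_rec : forall n, (n.+1%:R + al) ^+ 2 * p n =
  n.+1%:R * (n.+1%:R + 2 * al) * p n.+1.

(** The increments of [p] are only of order 2. Multiplying by [1 + al ^+ 2 / n.+1%:R] cancels their
    leading term, so that [isO_telescope] applies. *)
Lemma corner_expansion : isO 1 (fun n => p n - 1) ->
  isO 2 (fun n => p n - (1 - al ^+ 2 / n.+1%:R)).
Proof.
move=> p1.
pose y n := p n * (1 + al ^+ 2 / n.+1%:R).
have pO : isO 0 p.
  apply: isO_ext (isOD (isO_weak p1) (isO_cst 1)).
  by exists 0%N => n _; rewrite subrK.
have cO c : isO 1 (fun n => c / n.+1%:R : R[i]).
  by apply: isOMc; apply: isO_inv_nat.
have y1 : isO 1 (fun n => y n - 1).
  apply: isO_ext (isOD p1 (isOM pO (cO (al ^+ 2)))).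
  by exists 0%N => n _; rewrite /y; ring.
have y2 : isO 2 (fun n => y n - 1).
  apply: isO_telescope y1 _.
  (* By [p_rec] this product is exactly the increment of [y]. *)
  have := isOM (isOMc (al ^+ 2 * (1 - al) ^+ 2) pO)
    (isOM (isO_inv_nat R) (isOM (isO_inv 1) (isO_inv (2 * al)))).
  apply: isO_ext; exists 0%N => n _; rewrite /y.
  have n1 : n.+1%:R != 0 :> R[i] by rewrite pnatr_eq0.
  have n2 : n.+1%:R + 1 != 0 :> R[i] by rewrite natr1 pnatr_eq0.
  have -> : p n.+1 = (n.+1%:R + al) ^+ 2 * p n / (n.+1%:R * (n.+1%:R + 2 * al)).
    by rewrite p_rec mulrC mulKf // mulf_neq0.
  rewrite -[n.+2%:R]natr1; move: (n.+1%:R) n1 n2 (al2 n) => x x1 x2 x3.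
  by field; rewrite x1 x2.
have [N HN] := natr_add_neq0 (al ^+ 2).
(* This bounded sequence is the reciprocal of [1 + al ^+ 2 / n.+1%:R] and recovers [p] from [y]. *)
have fO : isO 0 (fun n => 1 - al ^+ 2 / (n.+1%:R + al ^+ 2)).
  apply: isO_ext (isOD (isO_cst 1) (isO_weak (isOMc (- al ^+ 2) (isO_inv (al ^+ 2))))).
  by exists 0%N => n _; rewrite mulNr.
have := isOM (isOD y2 (isOM (cO (al ^+ 2)) (cO (al ^+ 2)))) fO.
apply: isO_ext; exists N => n /HN; rewrite /y.
have n1 : n.+1%:R != 0 :> R[i] by rewrite pnatr_eq0.
by move: (n.+1%:R) n1 => x x1 x2; field; rewrite x1.
Qed.

Hypothesis pq : forall n, al * p n = (n%:R + al) * q n.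

Lemma corner_expansion_off : isO 1 (fun n => p n - 1) ->
  isO 2 (fun n => q n - al / n.+1%:R).
Proof.
move=> p1.
have := isOMc al (isOD (isOM p1 (isO_inv (al - 1)))
  (isOMc (1 - al) (isOM (isO_inv_nat R) (isO_inv (al - 1))))).
have [N HN] := natr_add_neq0 (al - 1).
apply: isO_ext; exists N => n /HN.
have n1 : n.+1%:R != 0 :> R[i] by rewrite pnatr_eq0.
have := pq n; have -> : n%:R + al = n.+1%:R + (al - 1) by rewrite -natr1; ring.
move: (n.+1%:R) n1 => x x1 e x2.
have -> : q n = al * p n / (x + (al - 1)) by rewrite e mulrC mulKf.
by field; rewrite x1.
Qed.

(** As [q] is of order 1, [q ^+ 2] is negligible, and [p ^+ 2] contributes
    [- 2 * al ^+ 2 / n.+1%:R]. *)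
Lemma corner_det_expansion (c1 c2 c3 : R[i]) : isO 1 (fun n => p n - 1) ->
  isO 2 (fun n => (1 + p n * c1 + q n * c2 + (p n ^+ 2 - q n ^+ 2) * c3) -
    (1 + c1 + c3 + al / n.+1%:R * (c2 - al * c1 - 2 * al * c3))).
Proof.
move=> p1; have r2 := corner_expansion p1; have s2 := corner_expansion_off p1.
have cO c : isO 1 (fun n => c / n.+1%:R : R[i]).
  by apply: isOMc; apply: isO_inv_nat.
have pO : isO 0 (fun n => p n + (1 - al ^+ 2 / n.+1%:R)).
  apply: isO_ext (isOD (isO_weak p1) (isOD (isO_cst 2) (isO_weak (cO (- al ^+ 2))))).
  by exists 0%N => n _; ring.
have qO : isO 0 (fun n => q n + al / n.+1%:R).
  apply: isO_ext (isOD (isO_weak (isO_weak s2)) (isO_weak (cO (2 * al)))).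
  by exists 0%N => n _; ring.
apply: isO_ext (isOD (isOMc c1 r2) (isOD (isOMc c2 s2)
  (isOMc c3 (isOD (isOD (isOM r2 pO) (isOM (cO (al ^+ 2)) (cO (al ^+ 2))))
    (isOMc (-1) (isOD (isOM s2 qO) (isOM (cO al) (cO al)))))))).
by exists 0%N => n _; ring.
Qed.

(* [X] is the ratio of the zeroth Fourier coefficients for the exponents
   [al + n] and [n], divided by [4 ^ al]. *)
Lemma corner_limit (X : nat -> R[i]) :
  p 0%N * X 0%N = (Epow al (ln 4))^-1 ->
  (forall n, (n.+1%:R + al) * ((2 * n + 1)%:R) * X n.+1 =
    n.+1%:R * ((2 * n + 1)%:R + 2 * al) * X n) ->
  isO 1 (fun n => X n - 1) -> isO 1 (fun n => p n - 1).
Proof.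
move=> pX0 X_rec XO.
pose b := 2 * al.
pose Z n := \prod_(i < n) (1 + b / (n + i).+1%:R).
pose P n := \prod_(i < n) (1 + b / i.+1%:R).
have PE n : P (n + n)%N = P n * Z n by rewrite /P big_split_ord.
have P0 n : P n != 0.
  apply/prodf_neq0 => i _; apply/eqP => e.
  have := al2 i; rewrite -/b -[b](mulfVK (_ : i.+1%:R != 0)) ?pnatr_eq0 //.
  by rewrite -[X in X + _]mul1r -mulrDl e mul0r eqxx.
have PS n : n.+1%:R * P n.+1 = (n.+1%:R + b) * P n.
  by rewrite /P big_ord_recr /=; field; rewrite addrC natr1 pnatr_eq0.
(* [Z n] is [P (n + n) / P n], so one step of [Z] is two steps of [PS] in the numerator against one
   in the denominator. *)
have Z_rec n : (n.+1%:R + b) * (2 * n + 1)%:R * Z n.+1 =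
    (n.+1%:R + al) * ((2 * n + 1)%:R + b) * Z n.
  apply: (mulfI (P0 n)).
  have -> : P n * ((n.+1%:R + b) * (2 * n + 1)%:R * Z n.+1) =
      n.+1%:R * (2 * n + 1)%:R * P (n.+1 + n.+1)%N.
    rewrite PE; transitivity ((2 * n + 1)%:R * Z n.+1 * (n.+1%:R * P n.+1)).
      by rewrite PS; ring.
    by ring.
  have := PS (n + n).+1; have := PS (n + n)%N.
  rewrite PE; have -> : (n.+1 + n.+1)%N = (n + n).+2 by lia.
  have -> : ((n + n).+2)%:R = 2 * n.+1%:R :> R[i] by rewrite -natrM; congr (_%:R); lia.
  have -> : (2 * n + 1)%:R = (n + n).+1%:R :> R[i] by congr (_%:R); lia.
  move=> e1 e2.
  have -> : n.+1%:R * (n + n).+1%:R * P (n + n).+2 =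
     (n + n).+1%:R * (2 * n.+1%:R * P (n + n).+2) / 2 by field.
  rewrite e2.
  have -> : (n + n).+1%:R * ((2 * n.+1%:R + b) * P (n + n).+1) / 2 =
    (2 * n.+1%:R + b) * ((n + n).+1%:R * P (n + n).+1) / 2 by ring.
  by rewrite e1 /b; field.
(* Both sides satisfy the same recurrence of first order, and they agree at 0 because
   [2 ^ (2 al) = 4 ^ al]. *)
have pX n : p n * X n = Z n / Epow b (ln 2).
  have E4 : Epow b (ln 2) = Epow al (ln 4).
    have -> : 4 = 2 * 2 :> R by rewrite -natrM.
    rewrite lnM ?posrE // /b /Epow rmorphD /=; congr Cexp; ring.
  elim: n => [|n IH].
    by rewrite pX0 E4 /Z big_ord0 mul1r.
  have d1 : (2 * n + 1)%:R != 0 :> R[i] by rewrite pnatr_eq0; lia.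
  have d2 : n.+1%:R != 0 :> R[i] by rewrite pnatr_eq0.
  have d3 := al1 n; have d4 := al2 n.
  apply: (mulfI (mulf_neq0 (mulf_neq0 d2 d4) (mulf_neq0 d3 d1))).
  have -> : n.+1%:R * (n.+1%:R + 2 * al) * ((n.+1%:R + al) * (2 * n + 1)%:R) *
    (p n.+1 * X n.+1) = (n.+1%:R * (n.+1%:R + 2 * al) * p n.+1) *
      ((n.+1%:R + al) * (2 * n + 1)%:R * X n.+1) by ring.
  rewrite -p_rec X_rec.
  have -> : n.+1%:R * (n.+1%:R + 2 * al) * ((n.+1%:R + al) * (2 * n + 1)%:R) *
    (Z n.+1 / Epow b (ln 2)) = n.+1%:R * (n.+1%:R + al) *
    ((n.+1%:R + b) * (2 * n + 1)%:R * Z n.+1) / Epow b (ln 2) by rewrite /b; ring.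
  rewrite Z_rec -/b.
  have -> : (n.+1%:R + al) ^+ 2 * p n * (n.+1%:R * ((2 * n + 1)%:R + b) * X n) =
    (n.+1%:R + al) ^+ 2 * (n.+1%:R * ((2 * n + 1)%:R + b)) * (p n * X n) by ring.
  by rewrite IH; ring.
have ZO : isO 1 (fun n => Z n / Epow b (ln 2) - 1).
  have [K K0 [N H]] := prod_ratio_bound b.
  exists (2 * K), N.+1 => n Nn; apply: (le_trans (H n (ltnW Nn))).
  have n0 : 0 < n%:R :> R by rewrite ltr0n; lia.
  have n1 : 1 <= n%:R :> R by rewrite ler1n; lia.
  rewrite expr1 -(natr1 n : _ = _ :> R) ler_pdivrMr // mulrAC ler_pdivlMr; last by lra.
  nra.
have [[N XN] XV] := isO_invf XO.
(* This is [p n - 1] written as [((p n * X n - 1) - (X n - 1)) / X n]. *)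
have := isOM (isOD ZO (isOMc (-1) XO)) XV.
apply: isO_ext; exists N => n /XN Xn.
by rewrite -pX; field.
Qed.

End CornerAsymptotics.

(** * Improper integrals *)

Section ImproperFTC.
Variable R : realType.
Notation mu := (@lebesgue_measure R).
Implicit Types (f g F G : R -> R).

Lemma is_derive_continuous G (x g' : R) : is_derive x 1 G g' -> {for x, continuous G}.
Proof.
by move=> dG; apply: differentiable_continuous; apply/derivable1_diffP; case: dG.
Qed.

Lemma FTC_cc f F (a b : R) : a < b ->
  (forall x, x \in `[a, b] -> is_derive x 1 F (f x)) ->
  (forall x, x \in `[a, b] -> {for x, continuous f}) ->
  (\int[mu]_(x in `[a, b]) (f x)%:E = (F b - F a)%:E)%E.
Proof.
move=> ab dF cf; rewrite EFinB; apply: continuous_FTC2 => //.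
- apply: continuous_in_subspaceT => x; rewrite inE => xi; exact: cf.
- have ai : a \in `[a, b] by rewrite in_itv /= lexx ltW.
  have bi : b \in `[a, b] by rewrite in_itv /= lexx ltW.
  split.
  + by move=> x xi; have [] := dF x (subset_itv_oo_cc xi).
  + by apply: cvg_at_right_filter; exact: is_derive_continuous (dF a ai).
  + by apply: cvg_at_left_filter; exact: is_derive_continuous (dF b bi).
- by move=> x xi; rewrite derive1E; have [_ ->] := dF x (subset_itv_oo_cc xi).
Qed.

(** Monotone convergence: the integral over each interval is an increment of [F], hence at most
    [M]. *)
Lemma integrable_bigcup_itv f F (u v : nat -> R) (M : R) :
  measurable_fun [set: R] f -> (forall n, u n < v n) ->
  nondecreasing_seq (fun n => [set` `[u n, v n]]) ->
  (forall n x, x \in `[u n, v n] -> is_derive x 1 F (f x)) ->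
  (forall n x, x \in `[u n, v n] -> {for x, continuous f}) ->
  (forall n x, x \in `[u n, v n] -> 0 <= f x) ->
  (forall n, F (v n) - F (u n) <= M) ->
  mu.-integrable (\bigcup_n [set` `[u n, v n]]) (EFin \o f).
Proof.
move=> mf uv nd dF cf f0 FM.
have /measurable_EFinP mE := mf.
apply/integrableP; split; first exact: measurable_funS mE.
have ->: (\int[mu]_(x in \bigcup_n [set` `[u n, v n]]) `|(EFin \o f) x| =
    \int[mu]_(x in \bigcup_n [set` `[u n, v n]]) (f x)%:E)%E.
  apply: eq_integral => x; rewrite inE => -[n _ xi] /=.
  by rewrite ger0_norm // (f0 n).
have cvgI : (\int[mu]_(x in [set` `[u n, v n]]) (EFin \o f) x)%E @[n --> \oo] -->
    (\int[mu]_(x in \bigcup_n [set` `[u n, v n]]) (EFin \o f) x)%E.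
  apply: (@ge0_nondecreasing_set_cvg_integral _ (measurableTypeR R) R
    (fun n => [set` `[u n, v n]]) (EFin \o f) mu nd) => //.
  by move=> n; exact: measurable_funS mE.
apply: le_lt_trans (ltry M).
rewrite -(cvg_lim _ cvgI) //; apply: lime_le; first by apply: cvgP cvgI.
apply: nearW => n; rewrite /= (FTC_cc (f := f) (F := F)) ?lee_fin //.
by move=> x; exact: (cf n).
Qed.

Lemma FTC_at_right f F (a b L : R) : a < b ->
  mu.-integrable `[a, b] (EFin \o f) ->
  (forall x, x \in `]a, b] -> is_derive x 1 F (f x)) ->
  (forall x, x \in `]a, b] -> {for x, continuous f}) ->
  F x @[x --> a^'+] --> L ->
  \int[mu]_(x in `[a, b]) f x = F b - L.
Proof.
move=> ab intf dF cf FL.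
pose I := \int[mu]_(x in `[a, b]) f x.
have h1 : (fun c => I - \int[mu]_(x in `[a, c]) f x) @ a^'+ --> I - 0.
  apply: cvgB; first exact: cvg_cst.
  apply: cvg_at_right_filter; exact: (@parameterized_integral_cvg_left R a b f ab intf).
have h2 : (fun c => I - \int[mu]_(x in `[a, c]) f x) @ a^'+ --> F b - L.
  apply: (cvg_trans _ (cvgB (cvg_cst (F b)) FL)).
  apply: near_eq_cvg; near=> c.
  have ac : a < c by near: c; exact: nbhs_right_gt.
  have cb : c < b by near: c; exact: nbhs_right_lt.
  rewrite /I Rintegral_itvB // ?bnd_simp ?(ltW ac) ?(ltW cb) //.
  rewrite Rintegral_itv_obnd_cbnd; last first.
    by apply: integrableS intf => //; apply: subset_itv; rewrite bnd_simp // ltW.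
  have sub x : x \in `[c, b] -> x \in `]a, b].
    by rewrite !in_itv /= => /andP[cx ->]; rewrite (lt_le_trans ac cx).
  by rewrite /Rintegral (FTC_cc cb (fun x xi => dF x (sub x xi))
    (fun x xi => cf x (sub x xi))).
rewrite -/I -[LHS]subr0; exact: cvg_unique h1 h2.
Unshelve. all: by end_near. Qed.

Lemma FTC_at_left f F (a b L : R) : a < b ->
  mu.-integrable `[a, b] (EFin \o f) ->
  (forall x, x \in `[a, b[ -> is_derive x 1 F (f x)) ->
  (forall x, x \in `[a, b[ -> {for x, continuous f}) ->
  F x @[x --> b^'-] --> L ->
  \int[mu]_(x in `[a, b]) f x = L - F a.
Proof.
move=> ab intf dF cf FL.
have h1 : (fun c => \int[mu]_(x in `[a, c]) f x) @ b^'- --> \int[mu]_(x in `[a, b]) f x.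
  exact: (@parameterized_integral_cvg_at_left R a b f ab intf).
have h2 : (fun c => \int[mu]_(x in `[a, c]) f x) @ b^'- --> L - F a.
  apply: (cvg_trans _ (cvgB FL (cvg_cst (F a)))).
  apply: near_eq_cvg; near=> c.
  have ac : a < c by near: c; exact: nbhs_left_gt.
  have cb : c < b by near: c; exact: nbhs_left_lt.
  have sub x : x \in `[a, c] -> x \in `[a, b[.
    by rewrite !in_itv /= => /andP[-> xc]; rewrite (le_lt_trans xc cb).
  by rewrite /Rintegral (FTC_cc ac (fun x xi => dF x (sub x xi))
    (fun x xi => cf x (sub x xi))).
exact: cvg_unique h1 h2.
Unshelve. all: by end_near. Qed.

End ImproperFTC.

(** * Integrals over the punctured circle *)

Section PuncturedCircle.
Variable R : realType.
Notation mu := (@lebesgue_measure R).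
Implicit Types (x : R).

(* [chord2 x] is [|1 - e^(ix)| ^ 2]. *)
Definition chord2 x : R := 2 - 2 * cos x.

(** The angle 0 is the singular point [t = 1]; both ends of the interval represent [t = -1]. *)
Definition pcircle : set R := `[- pi, pi] `\` [set 0].

Lemma pcircleP x : pcircle x <-> [/\ - pi <= x, x <= pi & x != 0].
Proof.
rewrite /pcircle /= in_itv /=; split.
  by move=> [/andP[-> ->] /eqP ->].
by move=> [-> ->] /eqP.
Qed.

Lemma chord2_half x : chord2 x = 4 * sin (x / 2) ^+ 2.
Proof.
rewrite /chord2 {1}(_ : x = (x / 2) *+ 2); last by rewrite -mulr_natr divfK.
by rewrite cos_mulr2n mulr2n; have := cos2Dsin2 (x / 2); lra.
Qed.

Lemma chord2_gt0 x : pcircle x -> 0 < chord2 x.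
Proof.
move=> /pcircleP[x1 x2 x0]; rewrite chord2_half mulr_gt0 // lt_neqAle sqr_ge0 andbT.
rewrite eq_sym sqrf_eq0.
have pi0 := pi_gt0 R.
have [xn|xp|xe] := ltgtP x 0; last by rewrite xe eqxx in x0.
  by rewrite -oppr_eq0 -sinN gt_eqF // sin_gt0_pi //; lra.
by rewrite gt_eqF // sin_gt0_pi //; lra.
Qed.

Lemma chord2_le4 x : chord2 x <= 4.
Proof. by rewrite /chord2; have := cos_geN1 x; lra. Qed.

Lemma cos_half_ge0 x : pcircle x -> 0 <= cos (x / 2).
Proof. by move=> /pcircleP[x1 x2 _]; apply: cos_ge0_pihalf; apply/andP; split; lra. Qed.

Lemma is_derive_chord2 x : is_derive x 1 chord2 (2 * sin x).
Proof. by apply: is_derive_eq; rewrite /GRing.scale /=; ring. Qed.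

Lemma is_derive_ln_chord2 x : pcircle x ->
  is_derive x 1 (fun y => ln (chord2 y)) (2 * sin x / chord2 x).
Proof.
move=> /chord2_gt0 w0.
have := @is_derive1_comp _ (@ln R) chord2 x _ _ (is_derive1_ln w0) (is_derive_chord2 x).
by rewrite mulrC.
Qed.

Lemma measurable_ln_chord2 : measurable_fun [set: R] (fun x => ln (chord2 x)).
Proof.
apply: (@measurableT_comp _ _ _ _ _ _ (@ln R)); first exact: measurable_ln.
apply: measurable_funB => //; apply: measurable_funM => //.
by apply: continuous_measurable_fun; exact: continuous_cos.
Qed.

(** [chord2] tends to 0 at the puncture, hence so does its power with positive exponent [c]. This
    removes boundary terms there. *)
Lemma cvg_pcircle0 (G : R -> R) c : 0 < c ->
  (forall x, pcircle x -> `|G x| <= expR (c * ln (chord2 x))) ->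
  G x @[x --> 0^'+] --> 0 /\ G x @[x --> 0^'-] --> 0.
Proof.
move=> c0 HG; have pi0 := pi_gt0 R.
have small e : 0 < e -> \forall x \near (0 : R), pcircle x -> `|G x| <= e.
  move=> e0; have : \forall x \near (0 : R), chord2 x < expR (ln e / c).
    have : chord2 x @[x --> (0 : R)] --> chord2 0.
      exact: is_derive_continuous (is_derive_chord2 0).
    move=> /cvgr_lt; apply; rewrite /chord2 cos0 mulr1 subrr; exact: expR_gt0.
  apply: filterS => x wx px; apply: (le_trans (HG x px)).
  have w0 := chord2_gt0 px.
  rewrite -[leRHS]lnK ?posrE // ler_expR mulrC -ler_pdivlMr //.
  by rewrite -ler_expR lnK ?posrE // ltW.
split; apply/cvgrPdist_le => e e0; near=> x; rewrite sub0r normrN.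
  have : pcircle x -> `|G x| <= e.
    by near: x; apply: cvg_at_right_filter (small e e0); exact: cvg_id.
  apply; apply/pcircleP.
  have x0 : 0 < x by near: x; exact: nbhs_right_gt.
  have xp : x < pi by near: x; exact: nbhs_right_lt.
  by split; [lra|lra|rewrite gt_eqF].
have : pcircle x -> `|G x| <= e.
  by near: x; apply: cvg_at_left_filter (small e e0); exact: cvg_id.
apply; apply/pcircleP.
have x0 : x < 0 by near: x; exact: nbhs_left_lt.
have xp : - pi < x by near: x; apply: nbhs_left_gt; lra.
by split; [lra|lra|rewrite lt_eqF].
Unshelve. all: by end_near. Qed.

Lemma measurable_pcircle : measurable (pcircle : set R).
Proof. by apply: measurableD. Qed.

Lemma pcircle_integrableP (f : R -> R) : measurable_fun [set: R] f ->
  mu.-integrable pcircle (EFin \o f) <-> mu.-integrable `[- pi, pi] (EFin \o f).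
Proof.
move=> mf; apply: iff_sym; apply: negligible_integrable => //.
  by apply/measurable_EFinP; exact: measurable_funS mf.
exact: lebesgue_measure_set1.
Qed.

Lemma Rintegral_pcircle (f : R -> R) : measurable_fun [set: R] f ->
  mu.-integrable pcircle (EFin \o f) ->
  \int[mu]_(x in pcircle) f x = \int[mu]_(x in `[- pi, pi]) f x.
Proof.
move=> mf /(pcircle_integrableP mf) intf.
rewrite /Rintegral /pcircle -(negligible_integral _ _ intf) //.
exact: lebesgue_measure_set1.
Qed.

Lemma FTC_pcircle (g G : R -> R) : measurable_fun [set: R] g ->
  mu.-integrable pcircle (EFin \o g) ->
  (forall x, pcircle x -> is_derive x 1 G (g x)) ->
  (forall x, pcircle x -> {for x, continuous g}) ->
  G x @[x --> 0^'+] --> 0 -> G x @[x --> 0^'-] --> 0 ->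
  \int[mu]_(x in pcircle) g x = G pi - G (- pi).
Proof.
move=> mg ig dG cg Gr Gl; have pi0 := pi_gt0 R.
rewrite Rintegral_pcircle //; move/(pcircle_integrableP mg) in ig.
have e := @Rintegral_itvB R g (BLeft (- pi)) (BRight pi) 0 ig.
rewrite !bnd_simp in e.
rewrite -[LHS](subrK (\int[mu]_(x in `[- pi, 0]) g x)) {}e; try lra.
have i1 : mu.-integrable `[0, pi] (EFin \o g).
  by apply: integrableS ig => //; apply: subset_itv; rewrite bnd_simp; lra.
have i2 : mu.-integrable `[- pi, 0] (EFin \o g).
  by apply: integrableS ig => //; apply: subset_itv; rewrite bnd_simp; lra.
rewrite Rintegral_itv_obnd_cbnd; last first.
  by apply: integrableS i1 => //; apply: subset_itv; rewrite bnd_simp.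
have s1 x : x \in `]0, pi] -> pcircle x.
  by rewrite in_itv /= => /andP[x1 x2]; apply/pcircleP; split; rewrite ?gt_eqF //; lra.
have s2 x : x \in `[- pi, 0[ -> pcircle x.
  by rewrite in_itv /= => /andP[x1 x2]; apply/pcircleP; split; rewrite ?lt_eqF //; lra.
rewrite (FTC_at_right pi0 i1 (fun x xi => dG x (s1 x xi)) (fun x xi => cg x (s1 x xi)) Gr).
have pi0' : - pi < 0 :> R by lra.
rewrite (FTC_at_left pi0' i2 (fun x xi => dG x (s2 x xi)) (fun x xi => cg x (s2 x xi)) Gl).
by ring.
Qed.

End PuncturedCircle.

(** * Integrability of the powers of [chord2] *)

Section Integrability.
Variable R : realType.
Notation mu := (@lebesgue_measure R).

Lemma integrable_setU (A B : set R) (f : R -> R) :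
  measurable A -> measurable B -> [disjoint A & B] ->
  measurable_fun [set: R] f ->
  mu.-integrable A (EFin \o f) -> mu.-integrable B (EFin \o f) ->
  mu.-integrable (A `|` B) (EFin \o f).
Proof.
move=> mA mB AB mf /integrableP[_ iA] /integrableP[_ iB].
have /measurable_EFinP mE := mf.
apply/integrableP; split; first exact: measurable_funS mE.
rewrite ge0_integral_setU //; first exact: lte_add_pinfty.
apply: measurableT_comp => //; exact: measurable_funS mE.
Qed.

Lemma integrable_scaleR (D : set R) (r : R) (f : R -> R) : measurable D ->
  mu.-integrable D (EFin \o f) -> mu.-integrable D (EFin \o (fun x => r * f x)).
Proof.
move=> mD intf.
rewrite (_ : EFin \o _ = (fun x => r%:E * (EFin \o f) x)%E); first exact: integrableZl.
by apply/funext => x /=; rewrite EFinM.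
Qed.

Lemma integrable_addR (D : set R) (f g : R -> R) : measurable D ->
  mu.-integrable D (EFin \o f) -> mu.-integrable D (EFin \o g) ->
  mu.-integrable D (EFin \o (fun x => f x + g x)).
Proof.
move=> mD intf intg.
rewrite (_ : EFin \o _ = (EFin \o f) \+ (EFin \o g))%E; first exact: integrableD.
by apply/funext => x /=; rewrite EFinD.
Qed.

Lemma le_integrableR (D : set R) (f g : R -> R) : measurable D ->
  measurable_fun [set: R] f -> (forall x, D x -> `|f x| <= g x) ->
  mu.-integrable D (EFin \o g) -> mu.-integrable D (EFin \o f).
Proof.
move=> mD mf fg; apply: le_integrable => //.
  by apply/measurable_EFinP; exact: measurable_funS mf.
move=> x Dx /=; rewrite lee_fin; exact: le_trans (fg x Dx) (ler_norm _).
Qed.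

Lemma is_derive_half (x : R) : is_derive x 1 (fun y : R => y / 2) (2^-1).
Proof. by apply: is_derive_eq; rewrite /GRing.scale /=; ring. Qed.

Lemma measurable_sin_cos_comp (g : R -> R) : measurable_fun [set: R] g ->
  measurable_fun [set: R] (fun x => sin (g x)) /\
  measurable_fun [set: R] (fun x => cos (g x)).
Proof.
move=> mg; split.
  apply: (@measurableT_comp _ _ _ _ _ _ (@sin R)) => //.
  by apply: continuous_measurable_fun; exact: continuous_sin.
apply: (@measurableT_comp _ _ _ _ _ _ (@cos R)) => //.
by apply: continuous_measurable_fun; exact: continuous_cos.
Qed.

Lemma measurable_exp_ln_chord2 (s : R) :
  measurable_fun [set: R] (fun x => expR (s * ln (chord2 x))).
Proof.
apply: (@measurableT_comp _ _ _ _ _ _ (@expR R)); first exact: measurable_expR.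
apply: measurable_funM => //; exact: measurable_ln_chord2.
Qed.

Lemma exp_ln_chord2_continuous (s x : R) : pcircle x ->
  {for x, continuous (fun y => expR (s * ln (chord2 y)))}.
Proof.
move=> /is_derive_ln_chord2 d.
apply: (@is_derive_continuous _ _ _ (expR (s * ln (chord2 x)) * (s * (2 * sin x / chord2 x)))).
Qed.

(* Up to a constant factor this function is the derivative of
   [sin (x / 2) * chord2 x ^ s], which is bounded. *)
Lemma integrable_chord2_pow_cos (s : R) : - 2^-1 < s ->
  mu.-integrable (@pcircle R)
    (EFin \o (fun x => (2^-1 + s) * cos (x / 2) * expR (s * ln (chord2 x)))).
Proof.
move=> s2; set g := fun x => _; have pi0 := pi_gt0 R.
pose F x := sin (x / 2) * expR (s * ln (chord2 x)).
have dF x : pcircle x -> is_derive x 1 F (g x).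
  move=> px; have d1 := is_derive_ln_chord2 px; have d2 := is_derive_half x.
  apply: is_derive_eq; rewrite /GRing.scale /= /g.
  have w0 := chord2_gt0 px.
  have s0 : sin (x / 2) != 0.
    by apply/eqP => e; move: w0; rewrite chord2_half e expr0n /= mulr0 ltxx.
  (* The logarithmic derivative of [chord2] is the cotangent of [x / 2], whose sine cancels against
     that in [F]. *)
  have -> : 2 * sin x / chord2 x = cos (x / 2) / sin (x / 2).
    rewrite chord2_half (_ : sin x = 2 * sin (x / 2) * cos (x / 2)).
      by field.
    rewrite {1}(_ : x = (x / 2) *+ 2); last by rewrite -mulr_natr divfK.
    by rewrite sin_mulr2n mulr2n; ring.
  by field.
have cg x : pcircle x -> {for x, continuous g}.
  move=> px; apply: continuousM; last exact: exp_ln_chord2_continuous.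
  apply: continuousM; first exact: cst_continuous.
  have d2 := is_derive_half x.
  have d := @is_derive1_comp _ (@cos R) (fun y => y / 2) x _ _ (is_derive_cos _) d2.
  exact: is_derive_continuous d.
have g0 x : pcircle x -> 0 <= g x.
  by move=> px; rewrite !mulr_ge0 ?expR_ge0 ?cos_half_ge0 //; lra.
have mg : measurable_fun [set: R] g.
  apply: measurable_funM; last exact: measurable_exp_ln_chord2.
  apply: measurable_funM => //.
  by apply: (measurable_sin_cos_comp _).2; exact: measurable_funM.
(* Cutoffs shrinking to the puncture; the denominator starts at 2 so that every interval is
   nondegenerate. *)
pose u n : R := pi / n.+2%:R.
have u0 n : 0 < u n by rewrite divr_gt0.
have upi n : u n < pi by rewrite ltr_pdivrMr // ltr_pMr // ltr1n.
have uS m n : (m <= n)%N -> u n <= u m.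
  by move=> mn; rewrite ler_pM2l // lef_pV2 ?posrE // ler_nat.
have ucvg x : 0 < x -> exists n, u n <= x.
  move=> x0; exists (Num.bound (pi / x)).
  have := archi_boundP (divr_ge0 (pi_ge0 R) (ltW x0)).
  rewrite ltr_pdivrMr // ler_pdivrMr // => h; apply: (le_trans (ltW h)).
  by rewrite [leRHS]mulrC ler_pM2r // ler_nat; apply: leqW; apply: leqW.
have pl n x : x \in `[- pi, - u n] -> pcircle x.
  rewrite in_itv /= => /andP[x1 x2]; apply/pcircleP; have := u0 n.
  by split; rewrite ?lt_eqF //; lra.
have pr n x : x \in `[u n, pi] -> pcircle x.
  rewrite in_itv /= => /andP[x1 x2]; apply/pcircleP; have := u0 n.
  by split; rewrite ?gt_eqF //; lra.
have -> : @pcircle R = (\bigcup_n [set` `[- pi, - u n]]) `|` (\bigcup_n [set` `[u n, pi]]).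
  apply/seteqP; split=> x.
    move=> /pcircleP[x1 x2 x0].
    have [xn|xp|xe] := ltgtP x 0; last by rewrite xe eqxx in x0.
      have [n un] := ucvg (- x) (ltac:(by rewrite oppr_gt0)).
      by left; exists n => //=; rewrite in_itv /= x1 /=; lra.
    have [n un] := ucvg x xp.
    by right; exists n => //=; rewrite in_itv /= x2 andbT.
  by move=> [|] [n _]; [exact: pl | exact: pr].
apply: integrable_setU => //.
- by apply: bigcup_measurable.
- by apply: bigcup_measurable.
- apply/disj_set2P; rewrite -subset0 => x [[n _ +] [m _]] /=; rewrite !in_itv /=.
  by have := u0 n; have := u0 m => ? ? /andP[] + + /andP[]; rewrite ?bnd_simp => *; suff : False by []; lra.
- apply: (@integrable_bigcup_itv _ g F (fun=> - pi) (fun n => - u n) (- F (- pi))).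
  + exact: mg.
  + by move=> n; have := upi n; lra.
  + move=> m n /uS mn; apply/subsetPset; apply: subset_itv; rewrite ?bnd_simp //; lra.
  + by move=> n x /pl; exact: dF.
  + by move=> n x /pl; exact: cg.
  + by move=> n x /pl; exact: g0.
  + move=> n; rewrite gerDr /F mulr_le0_ge0 ?expR_ge0 // mulNr sinN oppr_le0.
    by apply: sin_ge0_pi; have := u0 n; have := upi n => ? ?; apply/andP; split; lra.
- apply: (@integrable_bigcup_itv _ g F u (fun=> pi) (F pi)).
  + exact: mg.
  + exact: upi.
  + move=> m n /uS mn; apply/subsetPset; apply: subset_itv; rewrite ?bnd_simp //; lra.
  + by move=> n x /pr; exact: dF.
  + by move=> n x /pr; exact: cg.
  + by move=> n x /pr; exact: g0.
  + move=> n; rewrite gerBl /F mulr_ge0 ?expR_ge0 //.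
    by apply: sin_ge0_pi; have := u0 n; have := upi n => ? ?; apply/andP; split; lra.
Qed.

(** Split 1 into squared cosine and sine of [x / 2]. The cosine part is dominated by the previous
    lemma, since a cosine in [0, 1] exceeds its square; the sine part is a quarter of the power
    [s + 1], bounded by [c]. *)
Lemma integrable_chord2_pow (s : R) : - 2^-1 < s ->
  mu.-integrable (@pcircle R) (EFin \o (fun x => expR (s * ln (chord2 x)))).
Proof.
move=> s2; set c : R := expR ((s + 1) * ln 4) / 4.
have ic : mu.-integrable (@pcircle R) (EFin \o cst c).
  apply/(pcircle_integrableP (measurable_cst c)).
  apply: continuous_compact_integrable; first exact: segment_compact.
  by apply: continuous_subspaceT => y; exact: cst_continuous.
have mP := @measurable_pcircle R.
have ig := integrable_scaleR (2^-1 + s)^-1 mP (integrable_chord2_pow_cos s2).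
apply: (le_integrableR mP _ _ (integrable_addR mP ig ic)).
  exact: measurable_exp_ln_chord2.
move=> x px /=.
rewrite ger0_norm ?expR_ge0 // !mulrA mulVf ?mul1r; last by rewrite gt_eqF //; lra.
have w0 := chord2_gt0 px; have w4 := chord2_le4 x.
have c0 := cos_half_ge0 px; have c1 := cos_le1 (x / 2).
have e1 : expR (s * ln (chord2 x)) = cos (x / 2) ^+ 2 * expR (s * ln (chord2 x)) +
    expR ((s + 1) * ln (chord2 x)) / 4.
  rewrite [(s + 1) * _]mulrDl mul1r expRD (lnK w0) chord2_half.
  have := cos2Dsin2 (x / 2) => e.
  by rewrite -[LHS]mul1r -{1}e; field.
rewrite {1}e1 /=; apply: lerD.
  by rewrite ler_wpM2r ?expR_ge0 // expr2 ler_piMl //.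
rewrite ler_wpM2r // ler_expR ler_wpM2l //; first by lra.
by rewrite ler_ln ?posrE.
Qed.

End Integrability.

(** * Complex-valued integrals over the punctured circle *)

Section ComplexIntegral.
Variable R : realType.
Notation mu := (@lebesgue_measure R).
Notation pc := (@pcircle R).
Implicit Types F G : R -> R[i].

Definition Cintegrable F :=
  mu.-integrable pc (EFin \o (fun x => complex.Re (F x))) /\
  mu.-integrable pc (EFin \o (fun x => complex.Im (F x))).

Definition Cmeasurable F := measurable_fun [set: R] (fun x => complex.Re (F x)) /\
  measurable_fun [set: R] (fun x => complex.Im (F x)).

Lemma Re_mul (z1 z2 : R[i]) : complex.Re (z1 * z2) =
  complex.Re z1 * complex.Re z2 - complex.Im z1 * complex.Im z2.
Proof. by case: z1 z2 => ? ? []. Qed.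

Lemma Im_mul (z1 z2 : R[i]) : complex.Im (z1 * z2) =
  complex.Re z1 * complex.Im z2 + complex.Im z1 * complex.Re z2.
Proof. by case: z1 z2 => ? ? []. Qed.

Lemma Re_add (z1 z2 : R[i]) : complex.Re (z1 + z2) = complex.Re z1 + complex.Re z2.
Proof. by case: z1 z2 => ? ? []. Qed.

Lemma Im_add (z1 z2 : R[i]) : complex.Im (z1 + z2) = complex.Im z1 + complex.Im z2.
Proof. by case: z1 z2 => ? ? []. Qed.

Lemma complexP (z1 z2 : R[i]) : complex.Re z1 = complex.Re z2 ->
  complex.Im z1 = complex.Im z2 -> z1 = z2.
Proof. by case: z1 z2 => ? ? [? ?] /= -> ->. Qed.

Lemma Cmeasurable_mul F G : Cmeasurable F -> Cmeasurable G ->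
  Cmeasurable (fun x => F x * G x).
Proof.
move=> [F1 F2] [G1 G2]; split.
  under eq_fun do rewrite Re_mul.
  by apply: measurable_funB; apply: measurable_funM.
under eq_fun do rewrite Im_mul.
by apply: measurable_funD; apply: measurable_funM.
Qed.

Lemma Cmeasurable_add F G : Cmeasurable F -> Cmeasurable G ->
  Cmeasurable (fun x => F x + G x).
Proof.
move=> [F1 F2] [G1 G2]; split.
  by under eq_fun do rewrite Re_add; apply: measurable_funD.
by under eq_fun do rewrite Im_add; apply: measurable_funD.
Qed.

Lemma Cmeasurable_cst c : Cmeasurable (fun=> c).
Proof. by split; apply: measurable_cst. Qed.

Lemma Cmeasurable_real (g : R -> R) : measurable_fun [set: R] g ->
  Cmeasurable (fun x => (g x)%:C).
Proof. by split => //; apply: measurable_cst. Qed.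

Lemma Cmeasurable_expi (g : R -> R) : measurable_fun [set: R] g ->
  Cmeasurable (fun x => expi (g x)).
Proof. by move=> /measurable_sin_cos_comp[]. Qed.

Lemma Cmeasurable_Epow b (g : R -> R) : measurable_fun [set: R] g ->
  Cmeasurable (fun x => Epow b (g x)).
Proof.
move=> mg; case: b => s t.
have -> : (fun x => Epow (s +i* t) (g x)) =
   (fun x => (expR (s * g x))%:C * expi (t * g x)).
  by apply/funext => x; rewrite /Epow /Cexp; simpc.
apply: Cmeasurable_mul.
  apply: Cmeasurable_real; apply: (@measurableT_comp _ _ _ _ _ _ (@expR R)).
    exact: measurable_expR.
  exact: measurable_funM.
by apply: Cmeasurable_expi; exact: measurable_funM.
Qed.

Lemma le_Cintegrable F (g : R -> R) : Cmeasurable F ->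
  (forall x, pc x -> normc (F x) <= g x) ->
  mu.-integrable pc (EFin \o g) -> Cintegrable F.
Proof.
move=> [F1 F2] Fg ig; have mP := @measurable_pcircle R.
split; apply: (le_integrableR mP _ _ ig) => // x px.
  exact: le_trans (normRe _) (Fg x px).
exact: le_trans (normIm _) (Fg x px).
Qed.

Lemma Rintegral_lin (r s : R) (f g : R -> R) :
  mu.-integrable pc (EFin \o f) -> mu.-integrable pc (EFin \o g) ->
  \int[mu]_(x in pc) (r * f x + s * g x) =
  r * \int[mu]_(x in pc) f x + s * \int[mu]_(x in pc) g x.
Proof.
move=> intf intg; have mP := @measurable_pcircle R.
rewrite RintegralD //; last 2 first.
  exact: integrable_scaleR.
  exact: integrable_scaleR.
by rewrite !RintegralZl.
Qed.

Lemma integrable_lin (r s : R) (f g : R -> R) :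
  mu.-integrable pc (EFin \o f) -> mu.-integrable pc (EFin \o g) ->
  mu.-integrable pc (EFin \o (fun x => r * f x + s * g x)).
Proof.
move=> intf intg; have mP := @measurable_pcircle R.
by apply: integrable_addR => //; apply: integrable_scaleR.
Qed.

Lemma CintegralZ c F : Cintegrable F ->
  Cintegral pc (fun x => c * F x) = c * Cintegral pc F.
Proof.
move=> [F1 F2]; apply: complexP; rewrite /Cintegral /=.
  under eq_Rintegral do rewrite Re_mul -mulNr.
  by rewrite Rintegral_lin // Re_mul /= mulNr.
under eq_Rintegral do rewrite Im_mul.
by rewrite Rintegral_lin // Im_mul.
Qed.

Lemma CintegralD F G : Cintegrable F -> Cintegrable G ->
  Cintegral pc (fun x => F x + G x) = Cintegral pc F + Cintegral pc G.
Proof.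
move=> [F1 F2] [G1 G2]; have mP := @measurable_pcircle R.
apply: complexP; rewrite /Cintegral ?Re_add ?Im_add /=.
  by under eq_Rintegral do rewrite Re_add; rewrite RintegralD.
by under eq_Rintegral do rewrite Im_add; rewrite RintegralD.
Qed.

Lemma CintegrableZ c F : Cintegrable F -> Cintegrable (fun x => c * F x).
Proof.
move=> [F1 F2]; split.
  by under eq_fun do rewrite Re_mul -mulNr; apply: integrable_lin.
by under eq_fun do rewrite Im_mul; apply: integrable_lin.
Qed.

Lemma CintegrableD F G : Cintegrable F -> Cintegrable G ->
  Cintegrable (fun x => F x + G x).
Proof.
move=> [F1 F2] [G1 G2]; have mP := @measurable_pcircle R; split.
  by under eq_fun do rewrite Re_add; apply: integrable_addR.
by under eq_fun do rewrite Im_add; apply: integrable_addR.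
Qed.

Lemma eq_Cintegral F G : (forall x, pc x -> F x = G x) ->
  Cintegral pc F = Cintegral pc G.
Proof.
move=> FG; rewrite /Cintegral; congr (_ +i* _); apply: eq_Rintegral => x;
  by rewrite inE => /FG ->.
Qed.

Lemma normc_Cintegral F (g : R -> R) : Cintegrable F ->
  (forall x, pc x -> normc (F x) <= g x) ->
  mu.-integrable pc (EFin \o g) ->
  normc (Cintegral pc F) <= 2 * \int[mu]_(x in pc) g x.
Proof.
move=> [F1 F2] Fg ig; have mP := @measurable_pcircle R.
have bound (f : R -> R) : mu.-integrable pc (EFin \o f) ->
    (forall x, pc x -> `|f x| <= normc (F x)) ->
    `|\int[mu]_(x in pc) f x| <= \int[mu]_(x in pc) g x.
  move=> intf fF.
  apply: (@le_trans _ _ (\int[mu]_(x in pc) `|f x|)); first exact: le_normr_Rintegral.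
  apply: le_Rintegral => //; last by move=> x px; exact: le_trans (fF x px) (Fg x px).
  exact: integrable_norm.
apply: le_trans (normc_ReIm _) _; rewrite mulr_natl mulr2n.
by apply: lerD; apply: bound => // x _; [exact: normRe|exact: normIm].
Qed.

(** Differentiability of [G'] supplies its continuity, and the bound on [G] makes both one-sided
    limits at the puncture 0. *)
Lemma Cintegral_FTC G G' (c : R) : Cmeasurable G' -> Cintegrable G' ->
  (forall x, pc x -> is_cderive G x (G' x)) ->
  (forall x, pc x -> exists G'' : R[i], is_cderive G' x G'') ->
  0 < c -> (forall x, pc x -> normc (G x) <= expR (c * ln (chord2 x))) ->
  Cintegral pc G' = G pi - G (- pi).
Proof.
move=> [m1 m2] [i1 i2] dG dG' c0 Gc.
apply: complexP; rewrite /Cintegral /=.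
  have [Gr Gl] := @cvg_pcircle0 R (fun x => complex.Re (G x)) c c0
    (fun x px => le_trans (normRe _) (Gc x px)).
  rewrite (FTC_pcircle m1 i1 (fun x px => (dG x px).1) _ Gr Gl).
    by rewrite Re_add; case: (G (- pi)).
  by move=> x /dG'[G'' [d _]]; exact: is_derive_continuous d.
have [Gr Gl] := @cvg_pcircle0 R (fun x => complex.Im (G x)) c c0
  (fun x px => le_trans (normIm _) (Gc x px)).
rewrite (FTC_pcircle m2 i2 (fun x px => (dG x px).2) _ Gr Gl).
  by rewrite Im_add; case: (G (- pi)).
by move=> x /dG'[G'' [_ d]]; exact: is_derive_continuous d.
Qed.

End ComplexIntegral.

(** * Fourier coefficients of the symbol *)

Section FourierCoefficients.
Variable R : realType.
Notation mu := (@lebesgue_measure R).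
Notation pc := (@pcircle R).
Implicit Types (b : R[i]) (k : int) (x : R).

Lemma expiD x y : expi (x + y) = expi x * expi y.
Proof. by rewrite !expi_Epow EpowD. Qed.

Lemma normc_expi x : normc (expi x) = 1.
Proof. by rewrite expi_Epow normc_Epow /= mul0r expR0. Qed.

Lemma sin_int_pi k : sin (k%:~R * pi : R) = 0.
Proof.
have sinn (n : nat) : sin (n%:R * pi : R) = 0.
  elim: n => [|n IH]; first by rewrite mul0r sin0.
  by rewrite -natr1 mulrDl mul1r sinDpi IH oppr0.
case: (intP k) => [|n|n]; first by rewrite mul0r sin0.
  by rewrite -pmulrn.
by rewrite mulrNz mulNr sinN -pmulrn sinn oppr0.
Qed.

(* The integrand of the [k]-th Fourier coefficient of the symbol with exponent
   [b]; [hint] lacks the factor [1 / (2 pi)]. *)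
Definition hcoef b k x : R[i] := Epow b (ln (chord2 x)) * expi (- (k%:~R * x)).

Definition hint b k : R[i] := Cintegral pc (hcoef b k).

Lemma normc_hcoef b k x :
  normc (hcoef b k x) = expR (complex.Re b * ln (chord2 x)).
Proof. by rewrite /hcoef normcM normc_Epow normc_expi mulr1. Qed.

Lemma measurable_linear (c : R) : measurable_fun [set: R] (fun x => - (c * x)).
Proof.
apply: (@measurableT_comp _ _ _ _ _ _ (@GRing.opp R)) => //.
Qed.

Lemma Cmeasurable_hcoef b k : Cmeasurable (hcoef b k).
Proof.
apply: Cmeasurable_mul.
  by apply: Cmeasurable_Epow; exact: measurable_ln_chord2.
by apply: Cmeasurable_expi; exact: measurable_linear.
Qed.

Lemma Cintegrable_hcoef b k : - 2^-1 < complex.Re b -> Cintegrable (hcoef b k).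
Proof.
move=> b2; apply: (le_Cintegrable (Cmeasurable_hcoef b k)) (integrable_chord2_pow b2).
by move=> x _; rewrite normc_hcoef.
Qed.

Lemma is_cderive_hcoef b k x : pc x -> is_cderive (hcoef b k) x
  ((b * (2 * sin x / chord2 x)%:C - 'i%C * k%:~R) * hcoef b k x).
Proof.
move=> px; have d1 := is_derive_ln_chord2 px.
have d2 : is_derive x 1 (fun y : R => - (k%:~R * y)) (- k%:~R).
  by apply: is_derive_eq; rewrite /GRing.scale /=; ring.
apply: (is_cderive_eq (is_cderiveM (is_cderive_Epow b d1) (is_cderive_expi d2))).
by rewrite /hcoef rmorphN /= rmorph_int; ring.
Qed.

(** Multiplication by [1 - expi x] removes the pole of the cotangent of [x / 2]. *)
Lemma expi_sub1_half x : pc x ->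
  (2 * sin x / chord2 x)%:C * (1 - expi x) = - 'i%C * (1 + expi x).
Proof.
move=> /chord2_gt0 w0; have w1 : chord2 x != 0 by rewrite gt_eqF.
have e := cos2Dsin2 x.
apply: complexP; rewrite /expi; simpc; rewrite /= -/(chord2 x).
  have -> : 2 * sin x / chord2 x * (1 - cos x) = sin x * (chord2 x / chord2 x).
    by rewrite /chord2; field.
  by rewrite divff // mulr1; ring.
have s2 : sin x * sin x = (1 - cos x) * (1 + cos x).
  by move: e; rewrite !expr2 => e; lra.
have -> : 2 * sin x / chord2 x * sin x = (1 + cos x) * (chord2 x / chord2 x).
  rewrite {2}/chord2; move: (chord2 x)^-1 => v.
  have -> : 2 * sin x * v * sin x = 2 * (sin x * sin x) * v by ring.
  by rewrite s2; ring.
by rewrite divff // mulr1; ring.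
Qed.

Lemma normc_1_sub_expi x : pc x -> normc (1 - expi x) = expR (2^-1 * ln (chord2 x)).
Proof.
move=> /chord2_gt0 w0; rewrite /expi; simpc; rewrite /=.
have -> : (1 - cos x) ^+ 2 + (- sin x) ^+ 2 = expR (2^-1 * ln (chord2 x)) ^+ 2.
  rewrite -expRM_natr mulrAC mulVf // mul1r lnK ?posrE // /chord2.
  have := cos2Dsin2 x; nra.
by rewrite sqrtr_sqr ger0_norm // expR_ge0.
Qed.

Lemma hcoef_shift b k x : hcoef b k x = expi x * hcoef b (k + 1) x.
Proof.
rewrite /hcoef mulrCA -expiD; congr (_ * expi _).
by rewrite rmorphD /=; ring.
Qed.

Lemma hcoef_pi b k : hcoef b k (- pi) = hcoef b k pi.
Proof.
rewrite /hcoef /chord2 cosN; congr (_ * _).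
by rewrite /expi mulrN opprK cosN sinN sin_int_pi oppr0.
Qed.

(** [G] is the integrand times [(1 - t) / t] with [t = expi x]. It has equal values at the two ends
    and, since [complex.Re b + 1/2 > 0], vanishes at the puncture; so the integral of [G'] is 0. *)
Lemma hint_rec b k : - 2^-1 < complex.Re b ->
  (k%:~R + 1 + b) * hint b (k + 1) = (k%:~R - b) * hint b k.
Proof.
move=> b2.
pose G x := hcoef b (k + 1) x + (-1) * hcoef b k x.
pose c1 := - 'i%C * (k%:~R + 1 + b); pose c2 := 'i%C * (k%:~R - b).
pose G' x := c1 * hcoef b (k + 1) x + c2 * hcoef b k x.
have i1 j := Cintegrable_hcoef j b2.
have dG x : pc x -> is_cderive G x (G' x).
  move=> px; apply: is_cderive_eq.
    apply: is_cderiveD; first exact: is_cderive_hcoef.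
    by apply: is_cderiveM; [exact: is_cderive_cst|exact: is_cderive_hcoef].
  rewrite /G' mul0r add0r (hcoef_shift b k x); have := expi_sub1_half px.
  move: (_ %:C) (expi x) (hcoef b (k + 1) x) => u t h e.
  rewrite rmorphD /=.
  have -> : forall z, (b * u - 'i%C * (z + 1)) * h + -1 * ((b * u - 'i%C * z) * (t * h)) =
    b * (u * (1 - t)) * h - 'i%C * (z + 1) * h + 'i%C * z * t * h by move=> z; ring.
  by rewrite e /c1 /c2; ring.
have := @Cintegral_FTC R G G' (complex.Re b + 2^-1) _ _ dG.
have -> : G pi - G (- pi) = 0 by rewrite /G !hcoef_pi subrr.
move=> H; have {H} : Cintegral pc G' = 0.
  apply: H; last 1 first.
  - move=> x px; have -> : G x = hcoef b (k + 1) x * (1 - expi x).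
      by rewrite /G (hcoef_shift b k x); ring.
    rewrite normcM normc_hcoef normc_1_sub_expi // -expRD -mulrDl //.
  - apply: Cmeasurable_add; apply: Cmeasurable_mul;
      by [exact: Cmeasurable_cst|exact: Cmeasurable_hcoef].
  - by apply: CintegrableD; apply: CintegrableZ.
  - move=> x px; eexists; apply: is_cderiveD; apply: is_cderiveM;
      by [exact: is_cderive_cst|exact: is_cderive_hcoef].
  - lra.
rewrite CintegralD; [|exact: CintegrableZ|exact: CintegrableZ].
rewrite !CintegralZ // -!/(hint _ _) /c1 /c2 => e.
apply/eqP; rewrite -subr_eq0; apply/eqP.
have i0 : 'i%C != 0 :> R[i] by rewrite eq_complex /= oner_eq0 andbF.
apply: (mulfI i0); rewrite mulr0 -[RHS]oppr0 -[in RHS]e; ring.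
Qed.

(** Since [chord2] is [2 - t - 1/t] on the circle, raising the exponent by 1 combines the
    coefficients 0, 1 and -1; [hint_rec] at 0 and -1 reduces them to the zeroth. *)
Lemma hint_exponentS b : - 2^-1 < complex.Re b ->
  (b + 1) * hint (b + 1) 0 = 2 * (2 * b + 1) * hint b 0.
Proof.
move=> b2.
have e : hint (b + 1) 0 = 2 * hint b 0 - hint b 1 - hint b (-1).
  rewrite /hint.
  rewrite (@eq_Cintegral _ _ (fun x => 2 * hcoef b 0 x +
    ((-1) * hcoef b 1 x + (-1) * hcoef b (-1) x))).
    rewrite CintegralD ?CintegralD ?CintegralZ; first by ring.
    all: try exact: CintegrableD.
    all: try (apply: CintegrableZ; exact: Cintegrable_hcoef).
    all: try exact: Cintegrable_hcoef.
    apply: CintegrableD; apply: CintegrableZ; exact: Cintegrable_hcoef.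
  move=> x px.
  have ew : (chord2 x)%:C = 2 - expi (- x) - expi x.
    by apply: complexP; rewrite /expi /chord2 cosN sinN; simpc; rewrite /=; ring.
  rewrite /hcoef mul0r oppr0 mul1r (_ : (-1)%:~R * x = - x) ?opprK; last by rewrite mulrN1z mulN1r.
  rewrite EpowDl Epow1 lnK ?posrE ?chord2_gt0 // ew.
  have -> : expi 0 = 1 :> R[i] by rewrite /expi cos0 sin0.
  by ring.
have := hint_rec 0 b2; have := hint_rec (-1) b2.
rewrite add0r addNr mulr0z add0r sub0r rmorphN1 addNr add0r => e1 e2.
rewrite e.
have -> : (b + 1) * (2 * hint b 0 - hint b 1 - hint b (-1)) =
  2 * (b + 1) * hint b 0 - (1 + b) * hint b 1 + (-1 - b) * hint b (-1) by ring.
by rewrite e2 -e1; ring.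
Qed.

End FourierCoefficients.

(** * The zeroth coefficient under integer shifts of the exponent *)

Section ZerothCoefficient.
Variables (R : realType) (al : R[i]).
Hypothesis al_gt : - 2^-1 < complex.Re al.
Notation mu := (@lebesgue_measure R).
Notation pc := (@pcircle R).

Lemma Re_natr n : complex.Re (n%:R : R[i]) = n%:R.
Proof. by rewrite -(rmorph_nat (real_complex R)). Qed.

Lemma Re_natr_gt n : - 2^-1 < complex.Re (n%:R : R[i]).
Proof. by rewrite Re_natr; apply: (@lt_le_trans _ _ 0) => //; lra. Qed.

Lemma Re_al_natr_gt n : - 2^-1 < complex.Re (al + n%:R).
Proof. by rewrite Re_add Re_natr; apply: ltr_wpDr. Qed.

Lemma natr_al_neq0 n : n.+1%:R + al != 0.
Proof.
apply/eqP => /(congr1 (@complex.Re R)); rewrite Re_add Re_natr /= -natr1.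
by have := al_gt; have := ler0n R n; lra.
Qed.

Lemma natr_2al_neq0 n : n.+1%:R + 2 * al != 0.
Proof.
apply/eqP => /(congr1 (@complex.Re R)); rewrite Re_add Re_natr mulr_natl mulr2n Re_add.
by rewrite /= -natr1; have := al_gt; have := ler0n R n; lra.
Qed.

Lemma hcoef_nat n x : pc x -> hcoef n%:R 0 x = (chord2 x ^+ n)%:C.
Proof.
move=> px; rewrite /hcoef Epow_nat ?chord2_gt0 //.
by rewrite mul0r oppr0 /expi cos0 sin0 mulr1.
Qed.

(** In closed form, [2 * pi] times the central binomial coefficient ['C(2 * n, n)]. *)
Definition chord_moment n : R := \int[mu]_(x in pc) (chord2 x ^+ n).

Lemma hint_nat n : hint (n%:R : R[i]) 0 = (chord_moment n)%:C.
Proof.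
rewrite /hint (eq_Cintegral (hcoef_nat n)) /Cintegral /chord_moment /=.
by congr (_ +i* _); rewrite Rintegral_cst ?mul0r //; exact: measurable_pcircle.
Qed.

Lemma chord_moment0 : chord_moment 0 = 2 * pi.
Proof.
rewrite /chord_moment; under eq_Rintegral do rewrite expr0.
have pi0 := pi_gt0 R.
have m1 : measurable_fun [set: R] (fun=> 1 : R) by exact: measurable_cst.
rewrite Rintegral_pcircle //.
  have mE : mu `[- pi, pi]%classic = (2 * pi)%:E.
    rewrite lebesgue_measure_itv /= lte_fin ifT; last by lra.
    by rewrite -EFinD; congr EFin; lra.
  by rewrite Rintegral_cst // mul1r; exact: (congr1 fine mE).
apply/(pcircle_integrableP m1).
apply: continuous_compact_integrable; first exact: segment_compact.
by apply: continuous_subspaceT => y; exact: cst_continuous.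
Qed.

Lemma chord_momentS n :
  n.+1%:R * chord_moment n.+1 = 2 * (2 * n + 1)%:R * chord_moment n.
Proof.
have e := hint_exponentS (Re_natr_gt n); rewrite natr1 in e.
apply: (@complexI R); rewrite !(rmorphM (real_complex R)) /= !rmorph_nat -!hint_nat.
by rewrite e natrD natrM.
Qed.

Lemma chord_moment_gt0 n : 0 < chord_moment n.
Proof.
elim: n => [|n IH]; first by rewrite chord_moment0 mulr_gt0 // pi_gt0.
by rewrite -(@pmulr_rgt0 _ n.+1%:R) // chord_momentS mulr_gt0 // mulr_gt0 //.
Qed.

Lemma integrable_chord2X n : mu.-integrable pc (EFin \o (fun x => chord2 x ^+ n)).
Proof.
have [i1 _] := Cintegrable_hcoef 0 (Re_natr_gt n).
apply: eq_integrable i1; first exact: measurable_pcircle.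
by move=> x; rewrite inE => px; rewrite /comp hcoef_nat.
Qed.

(* As [m] grows, [chord2 ^ m] concentrates at [x = pi], where [chord2 = 4]. *)
Lemma hint_concentration m :
  normc (hint (al + m.+1%:R) 0 / Epow al (ln 4) - hint m.+1%:R 0) <=
  4 * normc al * (chord_moment m.+1 / (2 * m + 1)%:R).
Proof.
pose F x := (Epow al (ln 4))^-1 * hcoef (al + m.+1%:R) 0 x + (-1) * hcoef m.+1%:R 0 x.
(* This is [chord2 x ^+ m.+1] times the bound of [normc_Epow_sub1] at [ln (chord2 x / 4)], expanded
   into two moments. *)
pose g x := (8 * normc al) * chord2 x ^+ m + (- (2 * normc al)) * chord2 x ^+ m.+1.
have i1 := Cintegrable_hcoef 0 (Re_al_natr_gt m.+1).
have i2 := Cintegrable_hcoef 0 (Re_natr_gt m.+1).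
have iF : Cintegrable F by apply: CintegrableD; apply: CintegrableZ.
have ig : mu.-integrable pc (EFin \o g).
  by apply: integrable_lin; exact: integrable_chord2X.
have Fg x : pc x -> normc (F x) <= g x.
  move=> px; have w0 := chord2_gt0 px.
  have -> : F x = (chord2 x ^+ m.+1)%:C * (Epow al (ln (chord2 x) - ln 4) - 1).
    rewrite /F hcoef_nat // /hcoef EpowDl Epow_nat // mul0r oppr0 EpowD EpowN.
    by rewrite (_ : expi 0 = 1) ?mulr1; [ring|rewrite /expi cos0 sin0].
  rewrite normcM normc_real ger0_norm ?exprn_ge0 ?(ltW w0) //.
  have -> : g x = chord2 x ^+ m.+1 * (2 * normc al * (4 / chord2 x - 1)).
    by rewrite /g exprS; field; rewrite gt_eqF.
  rewrite ler_wpM2l ?exprn_ge0 ?(ltW w0) //.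
  have -> : 4 / chord2 x = expR (- (ln (chord2 x) - ln 4)).
    by rewrite opprB expRD expRN !lnK ?posrE.
  apply: normc_Epow_sub1; first by have := al_gt; lra.
  by rewrite subr_le0 ler_ln ?posrE // chord2_le4.
have := normc_Cintegral iF Fg ig.
have -> : Cintegral pc F = hint (al + m.+1%:R) 0 / Epow al (ln 4) - hint m.+1%:R 0.
  by rewrite /F CintegralD ?CintegralZ //; [rewrite mulrC mulN1r|exact: CintegrableZ..].
move=> H; apply: (le_trans H); rewrite Rintegral_lin; try exact: integrable_chord2X.
rewrite -!/(chord_moment _) le_eqVlt; apply/orP; left; apply/eqP.
have d0 : (2 * m + 1)%:R != 0 :> R by rewrite pnatr_eq0 addn1.
(* By the moment recurrence the two terms of [g] nearly cancel, leaving the factor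
   [1 / (2 m + 1)]. *)
have e := chord_momentS m.
have -> : chord_moment m = m.+1%:R * chord_moment m.+1 / (2 * (2 * m + 1)%:R).
  by rewrite e; field.
have -> : m.+1%:R = ((2 * m + 1)%:R + 1) / 2 :> R.
  by rewrite natrD natrM -natr1; field.
by field.
Qed.

(** The sequence to be used as [X] in [corner_limit]. *)
Definition moment_ratio n : R[i] :=
  hint (al + n%:R) 0 / (hint n%:R 0 * Epow al (ln 4)).

Lemma hint_nat_neq0 n : hint (n%:R : R[i]) 0 != 0.
Proof.
rewrite hint_nat; apply/eqP => -[/eqP]; apply/negP.
by rewrite gt_eqF // chord_moment_gt0.
Qed.

Lemma moment_ratio_rec n :
  (n.+1%:R + al) * (2 * n + 1)%:R * moment_ratio n.+1 =
  n.+1%:R * ((2 * n + 1)%:R + 2 * al) * moment_ratio n.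
Proof.
have e1 := hint_exponentS (Re_al_natr_gt n).
have e2 := hint_exponentS (Re_natr_gt n).
rewrite -addrA natr1 in e1; rewrite natr1 in e2.
have h1 := hint_nat_neq0 n; have h2 := hint_nat_neq0 n.+1; have h3 := Epow_neq0 al (ln 4).
have d1 : (2 * n + 1)%:R != 0 :> R[i] by rewrite pnatr_eq0 addn1.
have d2 : n.+1%:R != 0 :> R[i] by rewrite pnatr_eq0.
have n2 : (2 * n + 1)%:R = 2 * n%:R + 1 :> R[i] by rewrite natrD natrM.
rewrite /moment_ratio.
have -> : hint n.+1%:R 0 = 2 * (2 * n + 1)%:R * hint n%:R 0 / n.+1%:R :> R[i].
  by rewrite n2 -e2 mulrC mulKf.
have -> : (n.+1%:R + al) * (2 * n + 1)%:R * (hint (al + n.+1%:R) 0 /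
    (2 * (2 * n + 1)%:R * hint n%:R 0 / n.+1%:R * Epow al (ln 4))) =
  ((al + n.+1%:R) * hint (al + n.+1%:R) 0) * n.+1%:R /
    (2 * hint n%:R 0 * Epow al (ln 4)).
  by field; rewrite h1 h3 [1 + _]addrC natr1 d2 -n2.
by rewrite e1 n2; field; rewrite h1 h3.
Qed.

Lemma moment_ratio_isO : isO 1 (fun n => moment_ratio n - 1).
Proof.
exists (8 * normc al), 1%N => -[//|m] _.
have h0 := hint_nat_neq0 m.+1; have h3 := Epow_neq0 al (ln 4).
have -> : moment_ratio m.+1 - 1 =
    (hint (al + m.+1%:R) 0 / Epow al (ln 4) - hint m.+1%:R 0) / hint m.+1%:R 0.
  by rewrite /moment_ratio; field; rewrite h0 h3.
rewrite normcM normcV hint_nat normc_real -hint_nat.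
have J0 := chord_moment_gt0 m.+1; rewrite gtr0_norm // ler_pdivrMr //.
apply: (le_trans (hint_concentration m)).
have -> : 8 * normc al / m.+2%:R ^+ 1 * chord_moment m.+1 =
  4 * normc al * (chord_moment m.+1 * (2 / m.+2%:R)) by rewrite expr1; ring.
rewrite ler_wpM2l ?mulr_ge0 ?normc_ge0 // ler_wpM2l ?(ltW J0) //.
rewrite -[leRHS]invf_div lef_pV2 ?posrE ?divr_gt0 ?ltr0n ?addn1 //.
rewrite ler_pdivrMr // -natrM ler_nat; lia.
Qed.

(** Were it 0, the recurrence would make every [moment_ratio] vanish, although they tend to 1. *)
Lemma hint0_neq0 : hint al 0 != 0.
Proof.
apply/eqP => h0.
have X0 n : moment_ratio n = 0.
  elim: n => [|n IH]; first by rewrite /moment_ratio addr0 h0 mul0r.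
  have c0 : (n.+1%:R + al) * (2 * n + 1)%:R != 0.
    by rewrite mulf_neq0 ?natr_al_neq0 // pnatr_eq0 addn1.
  by apply: (mulfI c0); rewrite moment_ratio_rec IH !mulr0.
have [[N HN] _] := isO_invf moment_ratio_isO.
by have := HN N (leqnn N); rewrite X0 eqxx.
Qed.

End ZerothCoefficient.

(** * The symbol on the unit circle *)

Section Symbol.
Variable R : realType.
Notation mu := (@lebesgue_measure R).
Notation pc := (@pcircle R).

(** A positive real part avoids the negative axis, where conjugation does not negate the principal
    argument. *)
Lemma Carg_conj (z : R[i]) : 0 < complex.Re z -> Carg z^* = - Carg z.
Proof.
case: z => u v /= u0; rewrite /Carg /= sqrrN.
have [v0|v0|->] := ltgtP v 0.
- by rewrite oppr_ge0 (ltW v0) opprK.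
- by rewrite oppr_ge0 leNgt v0.
- rewrite oppr0 lexx expr0n /= addr0 sqrtr_sqr gtr0_norm // divff ?gt_eqF //.
  by rewrite acos1 oppr0.
Qed.

Lemma Clog_conj (z : R[i]) : 0 < complex.Re z ->
  Clog z^* + Clog z = (2 * ln (normc z))%:C.
Proof.
move=> z0; rewrite /Clog Carg_conj //.
have -> : complex.Re `|z^*| = normc z by case: z {z0} => u v /=; rewrite sqrrN.
have -> : complex.Re `|z| = normc z by case: z {z0}.
by simpc; congr (_ +i* _); ring.
Qed.

(** On the circle [1 - 1/t] is the conjugate of [1 - t], whose real part is positive off the
    puncture; the two logarithms add up to [ln (chord2 x)]. *)
Lemma symb_expi (al : R[i]) (x : R) : pc x ->
  symb_xi al (expi x) * symb_eta al (expi x) = Epow al (ln (chord2 x)).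
Proof.
move=> px; have w0 := chord2_gt0 px.
rewrite /symb_xi /symb_eta /Cpow -CexpD -mulrDr.
have -> : 1 - (expi x)^-1 = (1 - expi x)^*.
  rewrite expi_Epow -EpowN -!expi_Epow /expi cosN sinN; simpc.
  by rewrite /=.
rewrite Clog_conj; last by move: w0; rewrite /chord2 /expi; simpc => /=; lra.
rewrite normc_1_sub_expi // expRK mulrA divff // mul1r //.
Qed.

(** [f] inherits measurability from [g] off the puncture; the value at the single remaining point is
    harmless. *)
Lemma Rintegral_cc_pcircle (f g : R -> R) : (forall x, pc x -> f x = g x) ->
  measurable_fun [set: R] g -> mu.-integrable pc (EFin \o g) ->
  \int[mu]_(x in `[- pi, pi]) f x = \int[mu]_(x in pc) g x.
Proof.
move=> fg mg ig.
have mP := @measurable_pcircle R.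
have i0 : [set` `[- pi, pi]] = pc `|` [set 0].
  rewrite /pcircle setDKU //; move=> x /= ->; rewrite in_itv /=.
  by have := pi_gt0 R => pi0; apply/andP; split; lra.
have mf : measurable_fun [set` `[- pi, pi]] f.
  rewrite i0; apply/measurable_funU => //; split; last exact: measurable_fun_set1.
  apply: (eq_measurable_fun g); last exact: measurable_funS mg.
  by move=> x; rewrite inE => /fg ->.
have fi : mu.-integrable pc (EFin \o f).
  by apply: eq_integrable ig => // x; rewrite inE => px /=; rewrite fg.
have iD : mu.-integrable `[- pi, pi] (EFin \o f).
  apply/(@negligible_integrable _ _ R mu _ [set 0]) => //.
    exact/measurable_EFinP.
  exact: lebesgue_measure_set1.
rewrite /Rintegral (@negligible_integral _ _ R mu _ [set 0] _ _ _ iD) //.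
  by congr fine; apply: eq_integral => x; rewrite inE => px /=; rewrite fg.
exact: lebesgue_measure_set1.
Qed.

Lemma fourier_coef_symb (al : R[i]) (k : int) : - 2^-1 < complex.Re al ->
  fourier_coef (fun t : R[i] => symb_xi al t * symb_eta al t) k =
  ((2 * pi)^-1)%:C * hint al k.
Proof.
move=> al2; rewrite /fourier_coef; congr (_ * _); rewrite /hint /Cintegral.
have [i1 i2] := Cintegrable_hcoef k al2; have [m1 m2] := Cmeasurable_hcoef al k.
by congr (_ +i* _); apply: Rintegral_cc_pcircle => // x px; rewrite symb_expi.
Qed.

End Symbol.

(** * The determinant ratio *)

Section Assembly.
Variables (R : realType) (al : R[i]).
Hypothesis al_gt : - 2^-1 < complex.Re al.

Let a := fourier_coef (fun t : R[i] => symb_xi al t * symb_eta al t).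

Lemma symb_coef_rec (k : int) :
  (k%:~R + 1 + al) * a (k + 1) = (k%:~R - al) * a k.
Proof.
by rewrite /a !fourier_coef_symb // mulrCA hint_rec // mulrCA.
Qed.

Lemma symb_coef0_neq0 : a 0 != 0.
Proof.
rewrite /a fourier_coef_symb // mulf_neq0 ?hint0_neq0 //.
by rewrite eq_complex /= eqxx andbT invr_eq0 mulf_neq0 ?gt_eqF ?pi_gt0.
Qed.

Let p n : R[i] := inv_col a n 0 0.
Let q n : R[i] := inv_col a n ord_max 0.

Lemma inv_col_head_cvg : isO 1 (fun n => p n - 1).
Proof.
have rec := symb_coef_rec; have a0 := symb_coef0_neq0.
have n1 := natr_al_neq0 al_gt; have n2 := natr_2al_neq0 al_gt.
apply: (@corner_limit R al p n1 n2 _ (moment_ratio al)).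
- by move=> n; exact: inv_col_headS.
(* For size 1 the inverse entry is [2 * pi / hint al 0], which cancels all of [moment_ratio al 0]
   but the power of 4. *)
- rewrite /p (inv_col_head0 rec n1 n2 a0) /a fourier_coef_symb // /moment_ratio addr0.
  have h0 := hint0_neq0 al_gt; have h1 := Epow_neq0 al (ln 4).
  have pi0 : (2 * pi)%:C != 0 :> R[i].
    by rewrite eq_complex /= eqxx andbT mulf_neq0 ?gt_eqF ?pi_gt0.
  rewrite hint_nat chord_moment0 fmorphV /=.
  move: (hint al 0) (Epow al _) ((2 * pi)%:C) h0 h1 pi0 => x y z h0 h1 pi0.
  by field; rewrite h0 h1 pi0.
- exact: moment_ratio_rec.
- exact: moment_ratio_isO.
Qed.

(** By reversal the corners of the inverse are [p] on the diagonal and [q] off it. The size [n.+2]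
    keeps the four corner positions distinct. *)
Lemma det_ratio (E11 E12 E21 E22 : R[i]) n :
  \det (toep a n.+2 + corner_mx E11 E12 E21 E22 n.+2) / \det (toep a n.+2) =
  1 + p n.+1 * (E11 + E22) + q n.+1 * (E12 + E21) +
  (p n.+1 ^+ 2 - q n.+1 ^+ 2) * \det (mx2 E11 E12 E21 E22).
Proof.
have rec := symb_coef_rec; have a0 := symb_coef0_neq0.
have n1 := natr_al_neq0 al_gt; have n2 := natr_2al_neq0 al_gt.
rewrite det_add_corner; last exact: (toep_unit rec n1 n2 a0).
have e i := @toep_invE _ _ _ rec n1 n2 a0 n.+1 i.
rewrite !(e _).1 !(e _).2.
have -> : rev_ord 0 = ord_max :> 'I_n.+2 by apply: val_inj; rewrite /= subn1.
have -> : rev_ord ord_max = 0 :> 'I_n.+2 by apply: val_inj; rewrite /= subnn.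
rewrite -/(p n.+1) -/(q n.+1); move: (p _) (q _) => x y.
have -> : 1%:M + mx2 x y y x *m mx2 E11 E12 E21 E22 =
    mx2 (1 + (x * E11 + y * E21)) (x * E12 + y * E22)
      (y * E11 + x * E21) (1 + (y * E12 + x * E22)).
  apply/matrixP => i j; rewrite !mxE !big_ord_recl big_ord0 !mxE addr0.
  by case: (unliftP 0 i) => [i'|] ->; case: (unliftP 0 j) => [j'|] ->;
    rewrite ?(ord1 i') ?(ord1 j') /= ?add0r.
by rewrite !det_mx2; ring.
Qed.

Lemma det_ratio_expansion (E11 E12 E21 E22 : R[i]) :
  isO 2 (fun n => \det (toep a n.+1 + corner_mx E11 E12 E21 E22 n.+1) /
    \det (toep a n.+1) -
    (\det (mx2 (1 + E11) E12 E21 (1 + E22)) + al / n.+1%:R *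
       (E12 + E21 - al * (E11 + E22) - 2 * al * \det (mx2 E11 E12 E21 E22)))).
Proof.
have rec := symb_coef_rec; have a0 := symb_coef0_neq0.
have n1 := natr_al_neq0 al_gt; have n2 := natr_2al_neq0 al_gt.
have prec n : (n.+1%:R + al) ^+ 2 * p n = n.+1%:R * (n.+1%:R + 2 * al) * p n.+1.
  exact: inv_col_headS.
have pq n : al * p n = (n%:R + al) * q n by exact: inv_col_last.
have := @corner_det_expansion R al p q n2 prec pq
  (E11 + E22) (E12 + E21) (\det (mx2 E11 E12 E21 E22)) inv_col_head_cvg.
apply: isO_ext; exists 1%N => -[//|n] _; rewrite det_ratio; congr (_ - _).
by rewrite !det_mx2; ring.
Qed.

End Assembly.

(** The shift by one turns the last index, used by [isO], into the matrix size. *)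
Lemma isO_bigO (R : realType) (f g : nat -> R[i]^o) :
  isO 2 (fun n => f n.+1 - g n.+1) ->
  f = g +O_\oo (fun n : nat => (n%:R ^+ 2)^-1 : R[i]^o).
Proof.
move=> [K [N H]]; apply/eqaddOP; apply: eqO_bigO; apply/eqO_exP.
(* The constant has to be positive, whereas [K] carries no sign. *)
exists (`|K| + 1)%:C; first by rewrite ltcR ltr_wpDl.
exists N.+1 => // -[//|n] /= Nn.
have -> : `|f n.+1 - g n.+1| = (normc (f n.+1 - g n.+1))%:C by [].
have -> : `|(n.+1%:R ^+ 2)^-1 : R[i]| = (n.+1%:R ^+ 2)^-1%:C.
  by rewrite ger0_norm ?invr_ge0 ?exprn_ge0 // fmorphV rmorphXn rmorph_nat.
rewrite -rmorphM lecR; apply: (le_trans (H n _)); first exact: Nn.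
rewrite ler_wpM2r ?invr_ge0 ?exprn_ge0 //.
by have := ler_norm K; lra.
Qed.

Theorem corollary4p4 (R : realType) (alpha : R[i]) (E11 E12 E21 E22 : R[i])
    (halpha : - 2^-1 < complex.Re alpha) :
  let a := fun t : R[i] => symb_xi alpha t * symb_eta alpha t in
  let ratio : nat -> R[i]^o := fun n : nat =>
    \det (toeplitz a n + corner_mx E11 E12 E21 E22 n) / \det (toeplitz a n) in
  (ratio = (fun n : nat =>
     \det (mx2 (1 + E11) E12 E21 (1 + E22)) +
     alpha / n%:R *
       (E12 + E21 - alpha * (E11 + E22) -
        2 * alpha * \det (mx2 E11 E12 E21 E22)))
     +O_\oo (fun n : nat => (n%:R ^+ 2)^-1 : R[i]^o))
  /\
  (mx2 E11 E12 E21 E22 = mx2 0 1 1 0 ->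
   ratio = (fun n : nat => 2 * alpha * (alpha + 1) / n%:R)
     +O_\oo (fun n : nat => (n%:R ^+ 2)^-1 : R[i]^o)).
Proof.
move=> a ratio.
(* [toeplitz] unfolds to [toep] of the Fourier coefficients. *)
have main := isO_bigO (f := ratio) (g := fun n => _)
  (det_ratio_expansion halpha E11 E12 E21 E22).
split; first exact: main.
move=> E; have Ei i j : mx2 E11 E12 E21 E22 i j = mx2 0 1 1 0 i j by rewrite E.
have := Ei 0 0; have := Ei 0 1; have := Ei 1 0; have := Ei 1 1.
rewrite !mxE /= => e22 e21 e12 e11.
(* Here the constant determinant is 0 and the other one is -1, so the bracket becomes
   [2 + 2 * alpha]. *)
have -> : (fun n : nat => 2 * alpha * (alpha + 1) / n%:R) = (fun n : nat =>
     \det (mx2 (1 + E11) E12 E21 (1 + E22)) +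
     alpha / n%:R *
       (E12 + E21 - alpha * (E11 + E22) -
        2 * alpha * \det (mx2 E11 E12 E21 E22))).
  by apply/funext => n; rewrite !det_mx2 e11 e12 e21 e22; ring.
exact: main.
Qed.
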